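(* In the case of independent labels, if $J=2$, then for all $\theta\in\Theta^{\mathrm{ind}}$ and all $n\ge 2$, $$g^\star_\theta(Y_{1:n})=\pi_n\circ h^\star_\theta(Y_{1:n})\qquad \mathbb{P}_\theta\text{-almost surely.}$$
   Context: Model. $J\ge2$ is an integer, $\mathbb{X}=\{1,\dots,J\}$, $(\mathbb{Y},\mathcal{Y})$ is a Polish space with its Borel $\sigma$-field and $\mathcal{L}$ is a dominating measure on it. A parameter is $\theta=(\nu,Q,(f_x)_{x\in\mathbb{X}})$ with $\nu$ a probability vector on $\mathbb{X}$, $Q$ a $J\times J$ transition matrix and $f_x$ probability densities with respect to $\mathcal{L}$. Under $\mathbb{P}_\theta$ (expectation $\mathbb{E}_\theta$), $(X_i)_{i\ge1}$ is a Markov chain on $\mathbb{X}$ with initial law $\nu$ and transition matrix $Q$ and, conditionally on $(X_i)_{i\ge 1}$, the $Y_i$ are independent, $Y_i$ having density $f_{X_i}$. $Y_{1:n}=(Y_1,\dots,Y_n)$. $\Theta^{\mathrm{ind}}$ is the set of parameters for which all rows of $Q$ equal $\nu$ (so the $X_i$ are i.i.d. with law $\nu$). Clusterers and classifiers. $\mathcal{P}[n]$ is the set of partitions of $[n]=\{1,\dots,n\}$. An $n$-clusterer is a measurable map $g:\mathbb{Y}^n\to\mathcal{P}[n]$; an $n$-classifier is a measurable map $h=(h_1,\dots,h_n):\mathbb{Y}^n\to\mathbb{X}^n$. $\pi_n:\mathbb{X}^n\to\mathcal{P}[n]$ is $\pi_n(x_{1:n})=\{\{i:x_i=x\}:x\in\mathbb{X}\}\setminus\{\varnothing\}$,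 and $\Pi_n=\pi_n(X_{1:n})$. For partitions $A,B$ of $[n]$, $\ell(A,B)=1-\frac1n\sup_M\sum_{\{C,C'\}\in M}\mathrm{Card}(C\cap C')$, the supremum being over matchings $M$ between the blocks of $A$ and the blocks of $B$ in the complete bipartite graph (each block is in at most one edge). The Bayes clusterer $g^\star_\theta$ is the clusterer such that $g^\star_\theta(Y_{1:n})$ is the partition minimizing $g\mapsto\mathbb{E}_\theta[\ell(g(Y_{1:n}),\Pi_n)\mid Y_{1:n}]$. The (not necessarily unique) Bayes classifier $h^\star_\theta=(h^\star_{\theta,1},\dots,h^\star_{\theta,n})$ satisfies $\mathbb{P}_\theta(X_i=h^\star_{\theta,i}(Y_{1:n})\mid Y_{1:n})=\max_{x\in\mathbb{X}}\mathbb{P}_\theta(X_i=x\mid Y_{1:n})$ for $i=1,\dots,n$. *)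

(* Defs.v *)
From HB Require Import structures.
From mathcomp Require Import all_boot all_order all_algebra.
From mathcomp Require Import all_classical all_reals all_analysis.

Set Implicit Arguments.
Unset Strict Implicit.
Unset Printing Implicit Defensive.

Import Order.TTheory GRing.Theory Num.Theory.
Import numFieldNormedType.Exports.

Definition set_partition (n : nat) : Type :=
  {A : {set {set 'I_n}} | finset.partition A [set: 'I_n]%SET}.

Section loss.
Variable n : nat.
Implicit Types (A B : {set {set 'I_n}}).

Definition is_matching A B (M : {set {set 'I_n} * {set 'I_n}}) : bool :=
  [&& M \subset finset.setX A B,
      [forall e in M, forall e' in M, (e.1 == e'.1) ==> (e == e')]
    & [forall e in M, forall e' in M, (e.2 == e'.2) ==> (e == e')]].

Definition max_overlap A B : nat :=
  \max_(M : {set {set 'I_n} * {set 'I_n}} | is_matching A B M)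
     \sum_(e in M) #|e.1 :&: e.2|.

Definition loss (R : realType) (A B : set_partition n) : R :=
  (1 - (max_overlap (val A) (val B))%:R / n%:R)%R.

End loss.

Section pi_n.
Variables (J n : nat) (x : n.-tuple 'I_J).

Definition fibers : {set {set 'I_n}} :=
  ([set [set i | tnth x i == a] | a : 'I_J] :\ finset.set0)%SET.

Lemma fibers_partition : finset.partition fibers [set: 'I_n]%SET.
Proof.
apply/and3P; split.
- apply/eqP/setP => i; rewrite inE; apply/bigcupP.
  exists [set j | tnth x j == tnth x i]%SET; last by rewrite inE.
  rewrite !inE; apply/andP; split; last by apply/imsetP; exists (tnth x i).
  by apply/set0Pn; exists i; rewrite inE.
- apply/finset.trivIsetP => A B; rewrite !inE.
  move=> /andP[_ /imsetP[a _ ->]] /andP[_ /imsetP[b _ ->]] ab.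
  rewrite -setI_eq0; apply/eqP/setP => i; rewrite !inE.
  by apply/negP => /andP[/eqP -> /eqP E]; rewrite E eqxx in ab.
- by rewrite !inE eqxx.
Qed.

Definition pi_n : set_partition n := exist _ fibers fibers_partition.

End pi_n.

Local Open Scope classical_set_scope.
Local Open Scope ring_scope.

Definition is_metric (R : realType) (T : Type) (dist : T -> T -> R) : Prop :=
  [/\ forall x y, 0 <= dist x y,
      forall x y, dist x y = 0 <-> x = y,
      forall x y, dist x y = dist y x
    & forall x y z, dist x z <= dist x y + dist y z].

Definition polish_space (R : realType) (T : topologicalType) : Prop :=
  (exists2 D : set T, countable D & dense D) /\
  (exists dist : T -> T -> R,
    [/\ is_metric dist,
        forall (x : T) (A : set T),
          nbhs x A <-> exists2 e : R, 0 < e & [set y | dist x y < e] `<=` A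
      & forall u : nat -> T,
          (forall e : R, 0 < e -> exists N : nat, forall p q : nat,
             (N <= p)%N -> (N <= q)%N -> dist (u p) (u q) < e) ->
          exists l : T, u @ \oo --> l]).

(* The type T with its Borel sigma-field.  The carrier is pointed, hence
   nonempty, which is implied by the existence of a probability density. *)
Definition borel (T : ptopologicalType) := g_sigma_algebraType (@open T).

(* Measurability of a map into F equipped with the discrete sigma-field. *)
Definition discrete_mfun d (S : measurableType d) (F : Type) (g : S -> F) :
    Prop :=
  forall A : set F, measurable (g @^-1` A).

Section condexp.
Context (R : realType) (d : measure_display) (Omega : measurableType d).
Variable P : probability Omega R.

Definition is_condexp (G : set (set Omega)) (W Z : Omega -> R) : Prop :=
  [/\ forall B : set R, measurable B -> G (Z @^-1` B),
      P.-integrable setT (EFin \o Z)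
    & forall A, G A ->
        (\int[P]_(w in A) (Z w)%:E = \int[P]_(w in A) (W w)%:E)%E].

(* A chosen version of E[W | G].  Versions exist as soon as G is a sub-sigma-
   field and W is integrable, and are a.s. equal; the default value 0 is only
   reached otherwise. *)
Definition condexp (G : set (set Omega)) (W : Omega -> R) : Omega -> R :=
  xget (fun=> 0) [set Z | is_condexp G W Z].

Definition condprob (G : set (set Omega)) (A : set Omega) : Omega -> R :=
  condexp G (\1_A : Omega -> R).

End condexp.

Section model.
Context (R : realType) (T : ptopologicalType).
Variables (L : {measure set (borel T) -> \bar R}) (J : nat).

Record hmm_param := HmmParam {
  nu : 'I_J -> R ;
  Q : 'M[R]_J ;
  f : 'I_J -> borel T -> R ;
  nu_ge0 : forall x, 0 <= nu x ;
  nu_sum1 : \sum_x nu x = 1 ;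
  Q_ge0 : forall x y, 0 <= Q x y ;
  Q_sum1 : forall x, \sum_y Q x y = 1 ;
  f_ge0 : forall x y, 0 <= f x y ;
  f_meas : forall x, measurable_fun setT (f x) ;
  f_int1 : forall x, (\int[L]_y (f x y)%:E = 1)%E }.

Definition Theta_ind : set hmm_param :=
  [set theta | forall x y, Q theta x y = nu theta y].

Variable theta : hmm_param.
Context (d : measure_display) (Omega : measurableType d).
Variable P : probability Omega R.
(* Time is indexed from 0: X i and Y i stand for X_(i+1) and Y_(i+1). *)
Variables (X : nat -> Omega -> 'I_J) (Y : nat -> Omega -> borel T).

Definition markov_chain : Prop :=
  (forall x, P [set w | X 0 w = x] = (nu theta x)%:E) /\
  (forall (k : nat) (x : nat -> 'I_J),
     (P [set w | forall i, (i <= k.+1)%N -> X i w = x i] =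
      P [set w | forall i, (i <= k)%N -> X i w = x i]
        * (Q theta (x k) (x k.+1))%:E)%E).

Definition sigma_labels : set (set Omega) :=
  <<s \bigcup_i preimage_set_system setT (X i) discrete_measurable >>.

(* Given the whole sequence X, the Y_i are independent and Y_i has density
   f_(X_i). *)
Definition cond_indep_emissions : Prop :=
  forall (n : nat) (B : 'I_n -> set (borel T)),
    (forall i, measurable (B i)) ->
    is_condexp P sigma_labels
      (\1_[set w | forall i : 'I_n, B i (Y i w)] : Omega -> R)
      (fun w => \prod_(i < n) \int[L]_(y in B i) f theta (X i w) y).

Definition hmm_law : Prop :=
  [/\ forall i, discrete_mfun (X i),
      forall i, measurable_fun setT (Y i),
      markov_chain
    & cond_indep_emissions].

End model.

Section bayes.
Context (R : realType) (T : ptopologicalType) (J : nat).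
Context (d : measure_display) (Omega : measurableType d).
Variable P : probability Omega R.
Variables (X : nat -> Omega -> 'I_J) (Y : nat -> Omega -> borel T) (n : nat).

Definition Xn (w : Omega) : n.-tuple 'I_J := [tuple X i w | i < n].
Definition Yn (w : Omega) : n.-tuple (borel T) := [tuple Y i w | i < n].
Definition Pin (w : Omega) : set_partition n := pi_n (Xn w).

Definition sigma_obs : set (set Omega) := preimage_set_system setT Yn measurable.

Definition clusterer (g : n.-tuple (borel T) -> set_partition n) : Prop :=
  discrete_mfun g.

Definition classifier (h : n.-tuple (borel T) -> n.-tuple 'I_J) : Prop :=
  discrete_mfun h.

Definition cluster_risk (g : n.-tuple (borel T) -> set_partition n) :
    Omega -> R :=
  condexp P sigma_obs (fun w => loss R (g (Yn w)) (Pin w)).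

(* The minimizer need not be unique, so this is a predicate. *)
Definition bayes_clusterer (g : n.-tuple (borel T) -> set_partition n) : Prop :=
  clusterer g /\
  forall g', clusterer g' ->
    {ae P, forall w, cluster_risk g w <= cluster_risk g' w}.

(* The default value 0 of the maximum is harmless, conditional probabilities
   being a.s. nonnegative. *)
Definition bayes_classifier (h : n.-tuple (borel T) -> n.-tuple 'I_J) : Prop :=
  classifier h /\
  forall i : 'I_n,
    {ae P, forall w,
      condprob P sigma_obs [set w' | X i w' = tnth (h (Yn w')) i] w =
      \big[Num.max/0]_(x : 'I_J) condprob P sigma_obs [set w' | X i w' = x] w}.

End bayes.

(* Main.v *)
(** Idea.  Given the observations, the labels are independent with posterior
    weights p_i, so the conditional risk of a partition is one minus 1/n times
    the expected overlap of the partition with the random label classes.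

    A partition in at most two blocks amounts to a label vector s, and twice its
    overlap with x is n + |sum_i e_i|, where e_i = 1 if x_i = s_i and e_i = -1
    otherwise.  Writing p_i as a mixture of the point mass at the Bayes label h_i
    (weight m_i) and of the uniform law, each e_i is either deterministic, equal
    to +1 or -1 according to whether s_i = h_i, or a fair sign independent of s.
    As E|u + (sum of fair signs)| is strictly increasing in |u|, the choice s = h
    is optimal, and any optimal s agrees, up to a global swap of the labels, with
    h at all i such that m_i > 0.

    A partition with three blocks a, b, r or more is compared with the three
    partitions obtained by merging two of these blocks.  Weighting the merging of
    two of them by the size of the third one, the average overlap after merging is,
    for every x, at least the overlap before merging.  Hence three blocks are never
    better than two, and the case of equality is excluded by the description of
    the optimal two-block partitions.

    The product form of the posterior law of the labels is obtained by replacing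
    the label indicators by the posterior weights one index at a time. *)
Require Import Defs.
From HB Require Import structures.
From mathcomp Require Import all_boot all_order all_algebra.
From mathcomp Require Import all_classical all_reals all_analysis.
From mathcomp Require Import measurable_realfun zify ring lra.

Set Implicit Arguments.
Unset Strict Implicit.
Unset Printing Implicit Defensive.

Import Order.TTheory GRing.Theory Num.Theory.
Import numFieldNormedType.Exports.

Local Open Scope classical_set_scope.
Local Open Scope ring_scope.

(** * Absolute sums of independent signs *)

Definition sign_of (b : bool) : int := if b then 1 else -1.

Section SignedSums.
Variable R : realType.
Implicit Types (phi : int -> R) (u : int).

Lemma big_tuple_recl (K : finType) n (F : n.+1.-tuple K -> R) :
  \sum_x F x = \sum_a \sum_(t : n.-tuple K) F [tuple of a :: t].
Proof.
rewrite pair_big /=.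
rewrite (reindex (fun z : K * n.-tuple K => [tuple of z.1 :: z.2])) //=.
exists (fun x : n.+1.-tuple K => (thead x, [tuple of behead x])).
  by move=> [a t] _ /=; congr pair; apply/val_inj.
by move=> x _ /=; rewrite -tuple_eta.
Qed.

Lemma sum_prod_tuple (K : finType) n (q : 'I_n -> K -> R) :
  \sum_(x : n.-tuple K) \prod_(i < n) q i (tnth x i) = \prod_(i < n) \sum_a q i a.
Proof.
elim: n q => [|n IH] q.
  rewrite (big_pred1 [tuple]); first by rewrite !big_ord0.
  by move=> x; rewrite [x]tuple0 /= eqxx.
rewrite big_tuple_recl big_ord_recl big_distrl /=; apply: eq_bigr => a _.
under eq_bigr do rewrite big_ord_recl tnth0.
rewrite -big_distrr /= -(IH (fun i => q (lift ord0 i))); congr (_ * _).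
by apply: eq_bigr => x _; apply: eq_bigr => i _; rewrite tnthS.
Qed.

(** Expectation of [phi] at [u] plus a sum of signs, for independent labels with laws [p i]; each
    sign tells whether the label agrees with [s]. The offset [u] collects the signs already revealed
    in the inductions below. *)
Definition signed_sum n (p : 'I_n -> 'I_2 -> R) (s : n.-tuple 'I_2) phi u : R :=
  \sum_(x : n.-tuple 'I_2) (\prod_(i < n) p i (tnth x i)) *
     phi (u + \sum_(i < n) sign_of (tnth x i == tnth s i)).

(** Integrates out one fair sign. *)
Definition avg phi : int -> R := fun u => (phi (u + 1) + phi (u - 1)) / 2.

(* The arguments must have the same parity: otherwise avg would not preserve
   this monotonicity. *)
Definition even_mono phi :=
  forall u u' k : int, `|u| <= u' -> u' = u + 2 * k -> phi u <= phi u'.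
Definition even_smono phi :=
  forall u u' k : int, `|u| < u' -> u' = u + 2 * k -> phi u < phi u'.

(** By parity either |u| <= u' - 2, and the two shifts compare term by term, or u = u', or u = -u',
    where the comparison is made crosswise. *)
Lemma avg_mono phi : even_mono phi -> even_mono (avg phi).
Proof.
move=> H u u' k uu' E; rewrite /avg ler_pM2r ?invr_gt0 //.
have [->|/eqP uu] := eqVneq u u'; first by [].
have [e|/eqP uu2] := eqVneq u (- u').
  rewrite [leLHS]addrC; apply: lerD.
  - by apply: (H _ _ (u' + 1)); lia.
  - by apply: (H _ _ (u' - 1)); lia.
by apply: lerD; apply: (H _ _ k); lia.
Qed.

(** Parity gives |u| + 2 <= u'. As |u - 1| may still reach u' - 1, only the shift by +1 is compared
    strictly. *)
Lemma avg_smono phi : even_mono phi -> even_smono phi -> even_smono (avg phi).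
Proof.
move=> H H' u u' k uu' E; rewrite /avg ltr_pM2r ?invr_gt0 //.
by apply: ltr_leD; [apply: (H' _ _ k)|apply: (H _ _ k)]; lia.
Qed.

Lemma abs_mono : even_mono (fun u => `|u|%:~R).
Proof. by move=> u u' k uu' E; rewrite ler_int; lia. Qed.

Lemma abs_smono : even_smono (fun u => `|u|%:~R).
Proof. by move=> u u' k uu' E; rewrite ltr_int; lia. Qed.

Lemma signed_sum_cons n (p : 'I_n.+1 -> 'I_2 -> R) b (s : n.-tuple 'I_2) phi u :
  signed_sum p [tuple of b :: s] phi u =
  \sum_a p ord0 a *
    signed_sum (fun i => p (lift ord0 i)) s phi (u + sign_of (a == b)).
Proof.
rewrite /signed_sum big_tuple_recl; apply: eq_bigr => a _.
rewrite big_distrr /=; apply: eq_bigr => t _.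
rewrite !big_ord_recl /= mulrA !tnth0 addrA.
congr (_ * _ * phi (_ + _)); apply: eq_bigr => i _.
  by rewrite tnthS.
by rewrite !tnthS.
Qed.

Lemma signed_sum_avg n (p : 'I_n -> 'I_2 -> R) s phi u :
  signed_sum p s (avg phi) u =
  (signed_sum p s phi (u + 1) + signed_sum p s phi (u - 1)) / 2.
Proof.
rewrite /signed_sum -big_split /= big_distrl /=; apply: eq_bigr => x _.
by rewrite /avg -mulrDr mulrA; congr (_ * (phi _ + phi _) / _); ring.
Qed.

Lemma ord2_neq (a b c : 'I_2) : a != b -> (c == b) = (c != a).
Proof.
by case: a b c => [[|[|?]] ?] [[|[|?]] ?] [[|[|?]] ?].
Qed.

Lemma sum_ord2 (g : 'I_2 -> R) a b : a != b -> \sum_c g c = g a + g b.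
Proof.
move=> ab; rewrite (bigD1 a) //=; congr (_ + _).
by rewrite (eq_bigl (pred1 b)) ?big_pred1_eq // => c; rewrite /= -(ord2_neq c ab).
Qed.

(* p = m delta_h + (1 - m) uniform with m = 2 p h - 1; the uniform part is
   insensitive to the choice of b. *)
Lemma signed_sum_mix n (p : 'I_n.+1 -> 'I_2 -> R) (h b : 'I_2)
    (s : n.-tuple 'I_2) phi u (m := 2 * p ord0 h - 1)
    (p' := fun i => p (lift ord0 i)) :
  \sum_a p ord0 a = 1 ->
  signed_sum p [tuple of b :: s] phi u =
  m * signed_sum p' s phi (u + sign_of (h == b)) +
  (1 - m) * signed_sum p' s (avg phi) u.
Proof.
move=> p1; rewrite signed_sum_cons signed_sum_avg -/p'.
have [hb|hb] := eqVneq h b.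
  (* [rev_ord] exchanges the two labels. *)
  have bb : b != rev_ord b by case: (b) => [[|[|?]] ?].
  rewrite (sum_ord2 _ bb) eqxx eq_sym (negbTE bb) /=.
  move: p1; rewrite (sum_ord2 _ bb) /m hb => p1.
  by rewrite (_ : p ord0 (rev_ord b) = 1 - p ord0 b); [field|lra].
rewrite (sum_ord2 _ hb) eqxx (negbTE hb) /=.
move: p1; rewrite (sum_ord2 _ hb) /m => p1.
by rewrite (_ : p ord0 b = 1 - p ord0 h); [field|lra].
Qed.

(** Induction on [n] through the mixture. The uniform part turns [phi] into [avg phi] and leaves the
    offsets alone; the point mass adds 1 to [u'] and 1 or -1 to [u], which preserves both the bound
    and the common parity. This is why [phi], [u] and [u'] are arbitrary. *)
Lemma signed_sum_le n (p : 'I_n -> 'I_2 -> R) (h s : n.-tuple 'I_2) phi u u' k :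
  (forall i, \sum_a p i a = 1) ->
  (forall i, 1 <= 2 * p i (tnth h i) <= 2) ->
  even_mono phi -> `|u| <= u' -> u' = u + 2 * k ->
  signed_sum p s phi u <= signed_sum p h phi u'.
Proof.
elim: n p h s phi u u' k => [|n IH] p h s phi u u' k p1 ph phim uu' E.
  rewrite /signed_sum; apply: ler_sum => x _; rewrite !big_ord0 !mul1r !addr0.
  exact: phim E.
case/tupleP: h ph => b h ph; case/tupleP: s => a s.
have := ph ord0; rewrite tnth0 => /andP[ph0 ph2].
have ph' i : 1 <= 2 * p (lift ord0 i) (tnth h i) <= 2.
  by have := ph (lift ord0 i); rewrite tnthS.
rewrite !(@signed_sum_mix _ _ b) // eqxx; apply: lerD; apply: ler_wpM2l.
- by rewrite subr_ge0.
- case: eqP => _ /=; [apply: (IH _ _ _ _ _ _ k)|apply: (IH _ _ _ _ _ _ (k + 1))];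
  by rewrite // ?/sign_of; lia.
- by lra.
- by apply: (IH _ _ _ _ _ _ k) => //; exact: avg_mono.
Qed.

(** [m] selects the indices whose point mass has positive weight. Following the point mass at all of
    them, and the fair sign elsewhere, is a branch of positive weight; the strict bound on the
    deterministic signs collected there makes the comparison strict. *)
Lemma signed_sum_lt n (p : 'I_n -> 'I_2 -> R) (h s : n.-tuple 'I_2) phi u u' k
    (m := fun i => 1 < 2 * p i (tnth h i)) :
  (forall i, \sum_a p i a = 1) ->
  (forall i, 1 <= 2 * p i (tnth h i) <= 2) ->
  even_mono phi -> even_smono phi -> `|u| <= u' -> u' = u + 2 * k ->
  `|u + \sum_(i < n | m i) sign_of (tnth h i == tnth s i)| <
    u' + \sum_(i < n | m i) 1 ->
  signed_sum p s phi u < signed_sum p h phi u'.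
Proof.
elim: n p h s phi u u' k @m => [|n IH] p h s phi u u' k m p1 ph phim phis uu' E.
  rewrite !big_ord0 !addr0 => uu2; rewrite /signed_sum.
  rewrite !(big_pred1 [tuple]) /=; last 2 first.
    by move=> x; rewrite [x]tuple0 /= eqxx.
    by move=> x; rewrite [x]tuple0 /= eqxx.
  by rewrite !big_ord0 !mul1r !addr0; apply: phis E.
case/tupleP: h ph @m => b h ph m; case/tupleP: s => a s.
have := ph ord0; rewrite tnth0 => /andP[ph0 ph2].
have ph' i : 1 <= 2 * p (lift ord0 i) (tnth h i) <= 2.
  by have := ph (lift ord0 i); rewrite tnthS.
have sumS (F : 'I_n.+1 -> int) : \sum_(i < n.+1 | m i) F i =
    (if 1 < 2 * p ord0 b then F ord0 else 0) +
    \sum_(i < n | 1 < 2 * p (lift ord0 i) (tnth h i)) F (lift ord0 i).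
  rewrite big_mkcond big_ord_recl /m tnth0 [in RHS]big_mkcond; congr (_ + _).
  by apply: eq_bigr => i _; rewrite tnthS.
rewrite !sumS !tnth0.
under eq_bigr do rewrite !tnthS.
rewrite !(@signed_sum_mix _ _ b) // eqxx.
case: (ltrP 1 (2 * p ord0 b)) => ph1 lt; last first.
  (* The point mass has weight zero here, so only the fair sign remains. *)
  have e : 2 * p ord0 b - 1 = 0 by lra.
  rewrite e !mul0r !add0r !subr0 !mul1r.
  apply: (IH _ _ _ _ _ _ k) => //; [exact: avg_mono|exact: avg_smono|].
  by move: lt; rewrite !add0r.
(* Strictness is carried by the point mass, of positive weight; the uniform part is compared
   weakly. *)
apply: ltr_leD.
  rewrite ltr_pM2l ?subr_gt0 //.
  rewrite !addrA in lt.
  case: (b == a) lt => /= lt.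
    apply: (IH _ _ _ _ _ _ k) => //; first by lia.
    by rewrite /=; lia.
  apply: (IH _ _ _ _ _ _ (k + 1)) => //.
  - by lia.
  - by rewrite E /sign_of; lia.
apply: ler_wpM2l; first by lra.
by apply: (@signed_sum_le _ _ _ _ _ _ _ k) => //; exact: avg_mono.
Qed.

End SignedSums.

(** * Merging blocks *)

Section Labellings.
Variables (R : realType) (K : finType) (n : nat).
Hypothesis K2 : (1 < #|K|)%N.
Implicit Types (c : 'I_n -> K) (x s : n.-tuple 'I_2).

Definition block_count c x (u : K) (v : 'I_2) : nat :=
  (\sum_(i < n) ((c i == u) && (tnth x i == v)))%N.

Definition block_size c (u : K) : nat := (\sum_(i < n) (c i == u))%N.

(** Block names range over all of [K], including names that are not taken. A class left unmatched is
    thus matched with an empty block, and a matching is just an ordered pair of distinct names. *)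
Definition label_overlap c x : nat :=
  (\max_(z : K * K | z.1 != z.2)
     (block_count c x z.1 ord0 + block_count c x z.2 ord_max))%N.

Definition merge_labels c (a b : K) : 'I_n -> K := fun i => if c i == b then a else c i.

Lemma ord2P (v : 'I_2) : v = ord0 \/ v = ord_max.
Proof. by case: v => [[|[|?]] ?] //; [left|right]; exact: val_inj. Qed.

Lemma block_sizeE c x u v v' : v != v' ->
  block_size c u = (block_count c x u v + block_count c x u v')%N.
Proof.
move=> vv; rewrite /block_size /block_count -big_split /=; apply: eq_bigr => i _.
rewrite (ord2_neq (tnth x i) vv); by case: (c i == u) (tnth x i == v) => [] [].
Qed.

Lemma label_overlap_ge c x u u' v v' : u != u' -> v != v' ->
  (block_count c x u v + block_count c x u' v' <= label_overlap c x)%N.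
Proof.
move=> uu; have [->|->] := ord2P v; have [->|->] := ord2P v' => // _.
  exact: (leq_bigmax_cond (u, u') (F := fun z : K * K =>
    (block_count c x z.1 ord0 + block_count c x z.2 ord_max)%N)).
rewrite addnC; rewrite eq_sym in uu.
exact: (leq_bigmax_cond (u', u) (F := fun z : K * K =>
    (block_count c x z.1 ord0 + block_count c x z.2 ord_max)%N)).
Qed.

Lemma label_overlap_ex c x : exists u u', u != u' /\
  label_overlap c x = (block_count c x u ord0 + block_count c x u' ord_max)%N.
Proof.
have /card_gt1P[a [b [_ _ ab]]] : (1 < #|[set: K]%SET|)%N by rewrite cardsT.
have [|[u u'] /= uu E] := @eq_bigmax_cond _ [pred z : K * K | z.1 != z.2]
  (fun z => (block_count c x z.1 ord0 + block_count c x z.2 ord_max)%N).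
  by apply/card_gt0P; exists (a, b).
by exists u, u'.
Qed.

Lemma block_count_merge_ge c x a b u v :
  (block_count c x u v <=
   block_count (merge_labels c a b) x (if u == b then a else u) v)%N.
Proof.
apply: leq_sum => i _; rewrite /merge_labels.
by have [<-|] := eqVneq (c i) u => //=; rewrite eqxx.
Qed.

Lemma block_count_mergel c x a b v : a != b ->
  block_count (merge_labels c a b) x a v = (block_count c x a v + block_count c x b v)%N.
Proof.
move=> ab; rewrite /block_count -big_split /=; apply: eq_bigr => i _.
rewrite /merge_labels; have [->|cb] := eqVneq (c i) b.
  by rewrite !eqxx [b == a]eq_sym (negbTE ab).
by rewrite addn0.
Qed.

Lemma merge_overlap_ge c x a b u u' v v' : v != v' ->
  (if u == b then a else u) != (if u' == b then a else u') ->
  (block_count c x u v + block_count c x u' v' <= label_overlap (merge_labels c a b) x)%N.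
Proof.
move=> vv uu; apply: leq_trans (label_overlap_ge _ _ uu vv).
by apply: leq_add; exact: block_count_merge_ge.
Qed.

(** The merged block is matched with [v] and block [r] with [v']. *)
Lemma merge_overlap_ge3 c x a b r v v' : v != v' -> a != b -> r != a -> r != b ->
  (block_count c x a v + block_count c x b v + block_count c x r v' <=
   label_overlap (merge_labels c a b) x)%N.
Proof.
move=> vv ab ra rb; rewrite eq_sym in ra.
apply: leq_trans (label_overlap_ge _ _ ra vv).
rewrite block_count_mergel // leq_add2l.
by have := block_count_merge_ge c x a b r v'; rewrite (negbTE rb).
Qed.

(** Three blocks of sizes P, Q, R are split by label, and p0 + q1 is the overlap before merging.
    Merging r into p gains r0 and merging r into q gains r1, with weighted total Q r0 + P r1 >=
    min(P, Q) R. Merging p with q loses at most q1 and at most p0, hence at most min(P, Q), with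
    weight R. *)
Lemma merge_arith (p0 p1 q0 q1 r0 r1 Wrp Wrq Wpq : nat) :
  (p0 + r0 + q1 <= Wrp -> p0 + q1 + r1 <= Wrq ->
   p0 + q0 + r1 <= Wpq -> p1 + q1 + r0 <= Wpq ->
   (p0 + p1 + (q0 + q1) + (r0 + r1)) * (p0 + q1) <=
   (q0 + q1) * Wrp + (p0 + p1) * Wrq + (r0 + r1) * Wpq)%N.
Proof.
move=> H1 H2 H3 H4.
have K1 := leq_mul (leqnn (q0 + q1)) H1.
have K2' := leq_mul (leqnn (p0 + p1)) H2.
have K3 := leq_mul (leqnn (r0 + r1)) H3.
have K4 := leq_mul (leqnn (r0 + r1)) H4.
have [le|le] := leqP (q0 + q1) (p0 + p1).
  have L := leq_mul (leqnn r1) le; nia.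
have L := leq_mul (leqnn r0) (ltnW le); nia.
Qed.

(** [A], [B], [C] are the sizes of three blocks; the first contains [a0] labels of one kind and [a1]
    of the other, the last two only labels of the first kind. The final disjunction lists the
    possible values of the overlap [W] before merging. *)
Lemma merge_arith_lt (A B C a0 a1 W Wab War Wbr : nat) :
  (0 < A -> 0 < B -> 0 < C -> a1 <= a0 ->
   a0 + B <= Wab -> a1 + C <= Wab -> a0 + C <= War -> a1 + B <= War ->
   B + C + a1 <= Wbr -> a0 <= Wbr ->
   [\/ W <= a0, W <= B + a1 | W <= C + a1] ->
   (A + B + C) * W < C * Wab + B * War + A * Wbr)%N.
Proof.
move=> A0 B0 C0 a10 W1 W2 W3 W4 W5 W6 Wle.
(* Lower bounds on the gains of the three merges. The strict gain comes from joining the first two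
   blocks if W <= a0, and from joining the last two otherwise. *)
have [z [x [y [Wz Wx Wy pos]]]] : exists z x y : nat,
    [/\ W + z <= Wab, W + x <= War, W + y <= Wbr & 0 < C * z + B * x + A * y]%N.
  case: Wle => le.
  - exists B, 0%N, 0%N; rewrite !muln0 !addn0 muln_gt0 C0 B0; split => //; lia.
  - exists 0%N, 0%N, C; rewrite !muln0 !add0n muln_gt0 A0 C0; split => //; lia.
  - exists 0%N, 0%N, B; rewrite !muln0 !add0n muln_gt0 A0 B0; split => //; lia.
have := leq_add (leq_add (leq_mul (leqnn C) Wz) (leq_mul (leqnn B) Wx))
  (leq_mul (leqnn A) Wy).
by move: pos; clear; rewrite !mulnDr !mulnDl; lia.
Qed.

(** A merge can lower the overlap only by identifying the two matched blocks. If these are not both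
    among [a], [b], [r], each merge is harmless by itself; otherwise the weighted count of
    [merge_arith] applies. *)
Lemma merge_overlap c x a b r : a != b -> b != r -> r != a ->
  ((block_size c a + block_size c b + block_size c r) * label_overlap c x <=
   block_size c r * label_overlap (merge_labels c a b) x +
   block_size c b * label_overlap (merge_labels c a r) x +
   block_size c a * label_overlap (merge_labels c b r) x)%N.
Proof.
move=> ab br ra; have v01 : (ord0 : 'I_2) != ord_max by [].
have v10 : (ord_max : 'I_2) != ord0 by [].
have [ba rb ar] : [/\ b != a, r != b & a != r] by split; rewrite eq_sym.
have [u [u' [uu E]]] := label_overlap_ex c x.
have [/= H|/= H] := boolP ((u \in [:: a; b; r]) && (u' \in [:: a; b; r])); last first.
  have ge y z t : {subset [:: y; z] <= [:: a; b; r]} ->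
      (block_size c t * label_overlap c x <=
       block_size c t * label_overlap (merge_labels c y z) x)%N.
    move=> sub; apply: leq_mul => //; rewrite E; apply: merge_overlap_ge => //.
    have yI : y \in [:: a; b; r] by apply: sub; rewrite mem_head.
    have zI : z \in [:: a; b; r] by apply: sub; rewrite !inE eqxx orbT.
    case: (eqVneq u z) => [uz|_]; case: (eqVneq u' z) => [uz'|_] //.
    - by move: uu; rewrite uz uz' eqxx.
    - by apply: contraNneq H => <-; rewrite uz yI zI.
    - by apply: contraNneq H => ->; rewrite uz' yI zI.
  rewrite !mulnDl; have := ge a b r; have := ge a r b; have := ge b r a.
  have [s1 s2 s3] : [/\ {subset [:: b; r] <= [:: a; b; r]},
      {subset [:: a; r] <= [:: a; b; r]} & {subset [:: a; b] <= [:: a; b; r]}].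
    by split=> t; rewrite !inE => /orP[] ->; rewrite ?orbT.
  move=> /(_ s1) H1 /(_ s2) H2 /(_ s3) H3.
  rewrite addnC [X in (_ + X <= _)%N]addnC addnA.
  exact: leq_add (leq_add H3 H2) H1.
have W1 := merge_overlap_ge3 c x v01 ab ra rb.
have W2 := merge_overlap_ge3 c x v10 ab ra rb.
have W3 := merge_overlap_ge3 c x v01 ar ba br.
have W4 := merge_overlap_ge3 c x v10 ar ba br.
have W5 := merge_overlap_ge3 c x v01 br ab ar.
have W6 := merge_overlap_ge3 c x v10 br ab ar.
pose B := block_count c x; pose W c' := label_overlap c' x.
rewrite E !(block_sizeE c x _ v01).
(* One case for each ordered pair of blocks among [a], [b], [r] matched with the two labels. *)
move: H uu; rewrite !inE => /andP[/or3P[] /eqP-> /or3P[] /eqP->]; rewrite ?eqxx // => _.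
- have := @merge_arith (B a ord0) (B a ord_max) (B b ord0) (B b ord_max)
    (B r ord0) (B r ord_max) (W (merge_labels c a r)) (W (merge_labels c b r))
    (W (merge_labels c a b)).
  rewrite /B /W; lia.
- have := @merge_arith (B a ord0) (B a ord_max) (B r ord0) (B r ord_max)
    (B b ord0) (B b ord_max) (W (merge_labels c a b)) (W (merge_labels c b r))
    (W (merge_labels c a r)).
  rewrite /B /W; lia.
- have := @merge_arith (B b ord0) (B b ord_max) (B a ord0) (B a ord_max)
    (B r ord0) (B r ord_max) (W (merge_labels c b r)) (W (merge_labels c a r))
    (W (merge_labels c a b)).
  rewrite /B /W; lia.
- have := @merge_arith (B b ord0) (B b ord_max) (B r ord0) (B r ord_max)
    (B a ord0) (B a ord_max) (W (merge_labels c a b)) (W (merge_labels c a r))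
    (W (merge_labels c b r)).
  rewrite /B /W; lia.
- have := @merge_arith (B r ord0) (B r ord_max) (B a ord0) (B a ord_max)
    (B b ord0) (B b ord_max) (W (merge_labels c b r)) (W (merge_labels c a b))
    (W (merge_labels c a r)).
  rewrite /B /W; lia.
- have := @merge_arith (B r ord0) (B r ord_max) (B b ord0) (B b ord_max)
    (B a ord0) (B a ord_max) (W (merge_labels c a r)) (W (merge_labels c a b))
    (W (merge_labels c b r)).
  rewrite /B /W; lia.
Qed.

(* Here all three merges are at least as good as c, and merging b with r is
   strictly better. *)
Lemma merge_overlap_lt c x a b r v v' : v != v' -> a != b -> b != r -> r != a ->
  (0 < block_size c a)%N -> (0 < block_size c b)%N -> (0 < block_size c r)%N ->
  (forall i, c i \in [:: a; b; r]) ->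
  block_count c x b v' = 0 -> block_count c x r v' = 0 ->
  (block_count c x a v' <= block_count c x a v)%N ->
  ((block_size c a + block_size c b + block_size c r) * label_overlap c x <
   block_size c r * label_overlap (merge_labels c a b) x +
   block_size c b * label_overlap (merge_labels c a r) x +
   block_size c a * label_overlap (merge_labels c b r) x)%N.
Proof.
move=> vv ab br ra sa sb sr cI b0 r0 a10.
have v'v : v' != v by rewrite eq_sym.
have [ba rb ar] : [/\ b != a, r != b & a != r] by split; rewrite eq_sym.
have [u [u' [uu E]]] : exists u u', u != u' /\
    label_overlap c x = (block_count c x u v + block_count c x u' v')%N.
  have [u [u' [uu E]]] := label_overlap_ex c x.
  case: (ord2P v) vv {v'v b0 r0 a10} => ->; case: (ord2P v') => -> // _.
    by exists u, u'.
  by exists u', u; rewrite eq_sym addnC.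
have other w y : w != a -> w != b -> w != r -> block_count c x w y = 0.
  move=> wa wb wr; rewrite /block_count big1 // => i _.
  by have := cI i; rewrite !inE; have [->|//] := eqVneq (c i) w;
    rewrite (negbTE wa) (negbTE wb) (negbTE wr).
have sbE := block_sizeE c x b vv; have srE := block_sizeE c x r vv.
have W1 := merge_overlap_ge3 c x vv ab ra rb.
have W2 := merge_overlap_ge3 c x v'v ab ra rb.
have W3 := merge_overlap_ge3 c x vv ar ba br.
have W4 := merge_overlap_ge3 c x v'v ar ba br.
have W5 := merge_overlap_ge3 c x vv br ab ar.
have W6 := merge_overlap_ge3 c x v'v br ab ar.
move: sbE srE W1 W2 W3 W4 W5 W6; rewrite b0 r0 !addn0 => sbE srE.
rewrite -sbE -srE => W1 W2 W3 W4 W5 W6.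
(* Label [v'] occurs only in block [a]: either [a] is matched with [v'], or nothing is gained from
   [v']. *)
have {E} : [\/ label_overlap c x <= block_count c x a v,
    label_overlap c x <= block_size c b + block_count c x a v' |
    label_overlap c x <= block_size c r + block_count c x a v']%N.
  have count0 w : w != a -> block_count c x w v' = 0.
    move=> wa; have [->//|wb] := eqVneq w b; have [->//|wr] := eqVneq w r.
    exact: other.
  have u'le : (block_count c x u' v' <= block_count c x a v')%N.
    by have [->//|u'a] := eqVneq u' a; rewrite count0.
  have [ua|ua] := eqVneq u a.
    by constructor 1; rewrite E (count0 u') ?addn0 ?ua // eq_sym -ua.
  have [ub|ub] := eqVneq u b; first by constructor 2; rewrite E ub sbE leq_add2l.
  have [ur|ur] := eqVneq u r; first by constructor 3; rewrite E ur srE leq_add2l.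
  by constructor 1; rewrite E other // add0n (leq_trans u'le).
by move=> Wle; apply: (merge_arith_lt sa sb sr a10) W1 W2 W3 W4 W5 W6 Wle.
Qed.

Definition expected_overlap (p : 'I_n -> 'I_2 -> R) c : R :=
  \sum_(x : n.-tuple 'I_2) (\prod_(i < n) p i (tnth x i)) * (label_overlap c x)%:R.

(** The two names must differ even if only one of them is taken, so that one-block partitions are
    included. *)
Definition binary_labelling c s := exists u0 u1 : K, u0 != u1 /\
  forall i, c i = if tnth s i == ord0 then u0 else u1.

(** Only two matchings matter: one counts the agreements S of [x] with [s], the other the
    disagreements S'. Since S + S' = n, twice their maximum is n + |S - S'|. *)
Lemma binary_overlap c s x : binary_labelling c s ->
  2 * (label_overlap c x)%:Z =
  n%:Z + `|\sum_(i < n) sign_of (tnth x i == tnth s i)|.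
Proof.
move=> [u0 [u1 [u01 cE]]].
have v01 : (ord0 : 'I_2) != ord_max by [].
have v10 : (ord_max : 'I_2) != ord0 by [].
have u10 : u1 != u0 by rewrite eq_sym.
pose S := (block_count c x u0 ord0 + block_count c x u1 ord_max)%N.
pose S' := (block_count c x u0 ord_max + block_count c x u1 ord0)%N.
have nE : n = (S + S')%N.
  rewrite -[LHS]card_ord -sum1_card /S /S' /block_count -!big_split /=.
  apply: eq_bigr => i _; rewrite cE.
  case: (ord2P (tnth s i)) => ->; case: (ord2P (tnth x i)) => -> /=;
    by rewrite ?eqxx ?(negbTE u01) ?(negbTE u10).
have sE : \sum_(i < n) sign_of (tnth x i == tnth s i) = S%:Z - S'%:Z.
  rewrite /S /S' /block_count -!big_split /= !(big_morph Posz PoszD (erefl _)) -sumrB.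
  apply: eq_bigr => i _; rewrite cE.
  case: (ord2P (tnth s i)) => ->; case: (ord2P (tnth x i)) => -> /=;
    by rewrite ?eqxx ?(negbTE u01) ?(negbTE u10).
have ge1 : (S <= label_overlap c x)%N := label_overlap_ge c x u01 v01.
have ge2 : (S' <= label_overlap c x)%N := label_overlap_ge c x u01 v10.
have other u v : u != u0 -> u != u1 -> block_count c x u v = 0.
  move=> un0 un1; rewrite /block_count big1 // => i _; rewrite cE.
  by case: ifP => _; rewrite eq_sym ?(negbTE un0) ?(negbTE un1).
have le : (label_overlap c x <= maxn S S')%N.
  have [u [u' [uu ->]]] := label_overlap_ex c x.
  have [e0|ne0] := eqVneq u u0; last have [e1|ne1] := eqVneq u u1; last first.
  - rewrite other // add0n; have [e0'|ne0'] := eqVneq u' u0.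
      by rewrite e0' /S'; lia.
    have [e1'|ne1'] := eqVneq u' u1; first by rewrite e1' /S; lia.
    by rewrite other.
  - have [e0'|ne0'] := eqVneq u' u0; first by rewrite e1 e0' /S'; lia.
    by rewrite [X in (_ + X)%N]other // -?e1 1?eq_sym // e1 /S'; lia.
  - have [e1'|ne1'] := eqVneq u' u1; first by rewrite e0 e1' /S; lia.
    by rewrite [X in (_ + X)%N]other // -?e0 1?eq_sym // e0 /S; lia.
rewrite sE nE; lia.
Qed.

End Labellings.

(** * Optimal labellings *)

Section ExpectedOverlap.
Variables (R : realType) (K : finType) (n : nat).
Hypothesis K2 : (1 < #|K|)%N.
Implicit Types (c : 'I_n -> K) (x s : n.-tuple 'I_2).
Variables (p : 'I_n -> 'I_2 -> R) (h : n.-tuple 'I_2).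
Hypothesis p_ge0 : forall i a, 0 <= p i a.
Hypothesis p_sum1 : forall i, \sum_a p i a = 1.
Hypothesis p_h : forall i a, p i a <= p i (tnth h i).

(** The Bayes label at [i] is unique; otherwise the law [p i] is uniform. *)
Definition decided i := 1 < 2 * p i (tnth h i).

Lemma p_bayes i : 1 <= 2 * p i (tnth h i) <= 2.
Proof.
have v01 : (ord0 : 'I_2) != ord_max by [].
have := p_sum1 i; rewrite (sum_ord2 _ v01).
have := p_ge0 i ord0; have := p_ge0 i ord_max.
have := p_h i ord0; have := p_h i ord_max.
by case: (ord2P (tnth h i)) => ->; lra.
Qed.

Lemma undecided i a : ~~ decided i -> 0 < p i a.
Proof.
have v01 : (ord0 : 'I_2) != ord_max by [].
have := p_sum1 i; rewrite (sum_ord2 _ v01) /decided -leNgt.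
have := p_h i ord0; have := p_h i ord_max.
by case: (ord2P (tnth h i)) => ->; case: (ord2P a) => ->; lra.
Qed.

Lemma sum_prob_tuple : \sum_(x : n.-tuple 'I_2) \prod_(i < n) p i (tnth x i) = 1.
Proof. by rewrite sum_prod_tuple big1. Qed.

(** Expected overlap of the labelling given by the Bayes labels [h]; it turns out to be the maximum
    over all labellings. *)
Definition best_overlap : R :=
  (n%:R + signed_sum p h (fun u => `|u|%:~R) 0) / 2.

Lemma expected_binary c s : binary_labelling c s ->
  expected_overlap p c = (n%:R + signed_sum p s (fun u => `|u|%:~R) 0) / 2.
Proof.
move=> cs; have -> : (n%:R : R) =
    \sum_(x : n.-tuple 'I_2) (\prod_(i < n) p i (tnth x i)) * n%:R.
  by rewrite -big_distrl /= sum_prob_tuple mul1r.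
rewrite /signed_sum -big_split /= big_distrl /=; apply: eq_bigr => x _.
rewrite -mulrDr -mulrA; congr (_ * _); rewrite add0r.
have /(congr1 (fun z : int => z%:~R : R)) := binary_overlap K2 x cs.
by rewrite intrM intrD -!pmulrn => E; lra.
Qed.

Lemma expected_binary_le c s : binary_labelling c s ->
  expected_overlap p c <= best_overlap.
Proof.
move=> cs; rewrite (expected_binary cs) ler_pM2r ?invr_gt0 // lerD2l.
by apply: (@signed_sum_le _ _ _ _ _ _ _ _ 0); rewrite ?normr0 //;
  [exact: p_bayes|exact: abs_mono].
Qed.

(** The signs at [i] and [j] cancel, whereas both indices count on the right. *)
Lemma sum_sign_lt (P f : pred 'I_n) i j : P i -> P j -> f i -> ~~ f j ->
  `|\sum_(k < n | P k) sign_of (f k)| < \sum_(k < n | P k) 1.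
Proof.
move=> Pi Pj fi fj; have ji : j != i by apply: contraNneq fj => ->.
have Pij : P j && (j != i) by rewrite Pj.
rewrite (bigD1 i Pi) (bigD1 j Pij) [ltRHS](bigD1 i Pi) [in ltRHS](bigD1 j Pij) /=.
rewrite fi (negbTE fj) [sign_of true]/= [sign_of false]/=.
set s := \sum_(_ < _ | _) sign_of _.
have : `|s| <= \sum_(k < n | P k && (k != i) && (k != j)) 1.
  apply: le_trans (ler_norm_sum _ _ _) _; apply: ler_sum => k _.
  by case: (f k).
set t := \sum_(_ < _ | _) _; lia.
Qed.

(** If [s] agreed with [h] at one decided index and not at another, two deterministic signs would
    cancel and [signed_sum_lt] would contradict optimality. So on decided indices [s] is [h] or its
    swap, and both separate the same pairs. *)
Lemma expected_binary_eq c s i j : binary_labelling c s ->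
  best_overlap <= expected_overlap p c -> decided i -> decided j ->
  (c i == c j) = (tnth h i == tnth h j).
Proof.
move=> cs; rewrite (expected_binary cs) ler_pM2r ?invr_gt0 // lerD2l => le di dj.
have agree k l : decided k -> decided l ->
    tnth h k == tnth s k -> tnth h l == tnth s l.
  move=> dk dl fk; apply: contraLR le => fl; rewrite -ltNge.
  apply: (@signed_sum_lt _ _ _ _ _ _ _ _ 0); rewrite ?normr0 //;
    [exact: p_bayes|exact: abs_mono|exact: abs_smono|].
  by rewrite !add0r; apply: (@sum_sign_lt _ (fun k => tnth h k == tnth s k) k l).
have {agree} : (tnth h i == tnth s i) = (tnth h j == tnth s j).
  by apply/idP/idP; apply: agree.
case: cs => u0 [u1 [u01 cE]]; rewrite !cE.
by case: (ord2P (tnth h i)) => ->; case: (ord2P (tnth h j)) => ->;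
  case: (ord2P (tnth s i)) => ->; case: (ord2P (tnth s j)) => -> //=;
  rewrite ?eqxx ?(negbTE u01) ?[u1 == u0]eq_sym ?(negbTE u01).
Qed.

(** When fewer than two names are taken, the missing ones are chosen freely in [K]. *)
Lemma binary_labelling_ex c : (#|[set c i | i : 'I_n]%SET| <= 2)%N ->
  exists s, binary_labelling c s.
Proof.
move=> cI; have [u0 [u1 [u01 sub]]] : exists u0 u1 : K, u0 != u1 /\
    forall i, c i != u0 -> c i = u1.
  have /card_gt1P[a [b [_ _ ab]]] : (1 < #|[set: K]%SET|)%N by rewrite cardsT.
  have [E|[u0 u0I]] := set_0Vmem [set c i | i : 'I_n]%SET.
    exists a, b; split=> // i; have := imset_f c (erefl : i \in 'I_n).
    by rewrite E inE.
  have [E|[u1]] := set_0Vmem ([set c i | i : 'I_n] :\ u0)%SET.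
    have [u1 u01] : exists u1, u0 != u1.
      by have [->|] := eqVneq u0 a; [exists b|exists a].
    exists u0, u1; split=> // i ciu0.
    have : c i \in ([set c i | i : 'I_n] :\ u0)%SET.
      by rewrite !inE ciu0 imset_f.
    by rewrite E inE.
  rewrite !inE => /andP[u10 u1I]; exists u0, u1; rewrite eq_sym; split=> // i ciu0.
  apply/eqP; apply: contraTT cI => ciu1; rewrite -ltnNge; apply/card_gt2P.
  exists u0, u1, (c i); split; first by rewrite u0I u1I imset_f.
  by rewrite eq_sym u10 eq_sym ciu1 ciu0.
exists [tuple if c i == u0 then ord0 else ord_max | i < n], u0, u1; split=> // i.
rewrite tnth_mktuple; have [->|ci] := eqVneq (c i) u0; first by rewrite eqxx.
by rewrite (sub _ ci).
Qed.

Lemma block_size_gt0 c u : u \in [set c i | i : 'I_n]%SET -> (0 < block_size c u)%N.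
Proof.
by case/imsetP => i _ ->; rewrite /block_size (bigD1 i) //= eqxx.
Qed.

Lemma image_merge c a b : a != b -> a \in [set c i | i : 'I_n]%SET ->
  [set merge_labels c a b i | i : 'I_n]%SET = ([set c i | i : 'I_n] :\ b)%SET.
Proof.
move=> ab aI; apply/setP => u; rewrite !inE; apply/imsetP/andP.
  case=> i _ ->; rewrite /merge_labels; have [_|cib] := eqVneq (c i) b; first by [].
  by rewrite imset_f.
case=> ub /imsetP[i _ ui]; exists i => //.
by rewrite /merge_labels -ui (negbTE ub).
Qed.

Lemma expected_merge c a b r : a != b -> b != r -> r != a ->
  ((block_size c a)%:R + (block_size c b)%:R + (block_size c r)%:R) *
    expected_overlap p c <=
  (block_size c r)%:R * expected_overlap p (merge_labels c a b) +
  (block_size c b)%:R * expected_overlap p (merge_labels c a r) +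
  (block_size c a)%:R * expected_overlap p (merge_labels c b r).
Proof.
move=> ab br ra; rewrite /expected_overlap !big_distrr /= -!big_split /=.
apply: ler_sum => x _; rewrite !(mulrCA _ (\prod_(i < n) _)) -!mulrDr.
apply: ler_wpM2l; first exact: prodr_ge0.
rewrite -!natrD -!natrM -!natrD ler_nat; exact: merge_overlap.
Qed.

(** A single label vector of positive probability with a strict inequality suffices. It takes the
    Bayes labels on block [a] and a most frequent one of these everywhere else, where both labels
    have positive probability. *)
Lemma expected_merge_lt c a b r : a != b -> b != r -> r != a ->
  (0 < block_size c a)%N -> (0 < block_size c b)%N -> (0 < block_size c r)%N ->
  (forall i, c i \in [:: a; b; r]) ->
  (forall i, c i != a -> ~~ decided i) ->
  ((block_size c a)%:R + (block_size c b)%:R + (block_size c r)%:R) *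
    expected_overlap p c <
  (block_size c r)%:R * expected_overlap p (merge_labels c a b) +
  (block_size c b)%:R * expected_overlap p (merge_labels c a r) +
  (block_size c a)%:R * expected_overlap p (merge_labels c b r).
Proof.
move=> ab br ra sa sb sr cI dec; rewrite /expected_overlap !big_distrr /= -!big_split /=.
have [v [v' [vv maj]]] : exists v v' : 'I_2, v != v' /\
    (block_count c h a v' <= block_count c h a v)%N.
  have [le|/ltnW le] := leqP (block_count c h a ord0) (block_count c h a ord_max).
    by exists ord_max, ord0.
  by exists ord0, ord_max.
pose x := [tuple if c i == a then tnth h i else v | i < n].
have xa w : block_count c x a w = block_count c h a w.
  apply: eq_bigr => i _; rewrite tnth_mktuple.
  by case: (c i == a).
have xn w : w != a -> block_count c x w v' = 0%N.
  move=> wa; rewrite /block_count big1 // => i _; rewrite tnth_mktuple.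
  by have [->|] := eqVneq (c i) w => //=; rewrite (negbTE wa) (negbTE vv).
rewrite (bigD1 x) //= [ltRHS](bigD1 x) //=; apply: ltr_leD; last first.
  apply: ler_sum => y _; rewrite !(mulrCA _ (\prod_(i < n) _)) -!mulrDr.
  apply: ler_wpM2l; first exact: prodr_ge0.
  rewrite -!natrD -!natrM -!natrD ler_nat; exact: merge_overlap.
rewrite !(mulrCA _ (\prod_(i < n) _)) -!mulrDr ltr_pM2l.
  rewrite -!natrD -!natrM -!natrD ltr_nat.
  by apply: (merge_overlap_lt K2 vv) => //; rewrite ?xa ?xn // eq_sym.
apply: prodr_gt0 => i _; rewrite tnth_mktuple.
case: ifP => cia; last by apply: undecided; apply: dec; rewrite cia.
by have /andP[] := p_bayes i; lra.
Qed.

(** If a weighted mean of numbers at most M is at least E >= M, then all of them equal M and the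
    mean is E. Only the claim on [E1] is stated, the other ones following by permuting the
    blocks. *)
Lemma weighted_le_max (A B C E E1 E2 E3 M : R) : 0 < A -> 0 < B -> 0 < C ->
  M <= E -> E1 <= M -> E2 <= M -> E3 <= M ->
  (A + B + C) * E <= C * E1 + B * E2 + A * E3 ->
  M <= E1 /\ C * E1 + B * E2 + A * E3 <= (A + B + C) * E.
Proof.
move=> A0 B0 C0 ME E1M E2M E3M le.
have k1 : B * E2 <= B * M by rewrite ler_pM2l.
have k2 : A * E3 <= A * M by rewrite ler_pM2l.
have k3 : (A + B + C) * M <= (A + B + C) * E by rewrite ler_pM2l // !addr_gt0.
split; last by have k4 : C * E1 <= C * M by [rewrite ler_pM2l]; lra.
rewrite leNgt; apply/negP => lt.
have k4 : C * E1 < C * M by rewrite ltr_pM2l.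
lra.
Qed.

(** Strong induction on the number of blocks. If [c] reached the optimum, every merge of two of its
    blocks would reach it too. This forces exactly three blocks, then decided indices in two
    different blocks, and finally two optimal merges that disagree on whether to join these
    indices. *)
Lemma expected_ternary_lt c : (2 < #|[set c i | i : 'I_n]%SET|)%N ->
  expected_overlap p c < best_overlap.
Proof.
have [k] := ubnP #|[set c i | i : 'I_n]%SET|; elim: k c => // k IH c.
rewrite ltnS => ck c2; rewrite ltNge; apply/negP => ge.
set I := [set c i | i : 'I_n]%SET in ck c2.
have le_best c' : (#|[set c' i | i : 'I_n]%SET| < k)%N ->
    expected_overlap p c' <= best_overlap.
  move=> c'k; have [c'2|c'2] := leqP #|[set c' i | i : 'I_n]%SET| 2.
    by have [s] := binary_labelling_ex c'2; exact: expected_binary_le.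
  by apply: ltW; apply: IH.
have card_merge a b : a != b -> a \in I -> b \in I ->
    #|[set merge_labels c a b i | i : 'I_n]%SET|.+1 = #|I|.
  by move=> ab aI bI; rewrite image_merge // [RHS](cardsD1 b) bI.
have merge_le a b : a != b -> a \in I -> b \in I ->
    expected_overlap p (merge_labels c a b) <= best_overlap.
  by move=> ab aI bI; apply: le_best; rewrite card_merge.
have sz a : a \in I -> 0 < (block_size c a)%:R :> R.
  by move=> aI; rewrite ltr0n; exact: block_size_gt0.
have merge_eq a b r : [/\ a \in I, b \in I & r \in I] ->
    [/\ a != b, b != r & r != a] ->
    best_overlap <= expected_overlap p (merge_labels c a b).
  move=> [aI bI rI] [ab br ra].
  have ar : a != r by rewrite eq_sym.
  by case: (weighted_le_max (sz _ aI) (sz _ bI) (sz _ rI) ge (merge_le _ _ ab aI bI)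
    (merge_le _ _ ar aI rI) (merge_le _ _ br bI rI) (expected_merge c ab br ra)).
have I3 : #|I| = 3.
  have /card_gt2P[a [b [r [[aI bI rI] [ab br ra]]]]] := c2.
  apply/eqP; rewrite eqn_leq c2 andbT -(card_merge a b) // ltnS leqNgt.
  apply/negP => m2.
  have := merge_eq a b r; rewrite leNgt IH ?card_merge //.
  by move=> H; have := H (And3 aI bI rI) (And3 ab br ra).
have IE a b r : [/\ a \in I, b \in I & r \in I] ->
    [/\ a != b, b != r & r != a] -> forall i, c i \in [:: a; b; r].
  move=> [aI bI rI] [ab br ra] i.
  have : I = [set a; b; r]%SET.
    apply/esym/eqP; rewrite eqEcard; apply/andP; split.
      by apply/fintype.subsetP => w; rewrite !inE => /orP[/orP[]|] /eqP->.
    by rewrite I3 -finset.setUA cardsU1 cards2 br !inE negb_or ab eq_sym ra.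
  by move/setP/(_ (c i)); rewrite imset_f // !inE orbA.
(* If all decided indices were in block [a], the merging inequality would be strict, which
   optimality of [c] and of its merges excludes. *)
have some_decided a b r : [/\ a \in I, b \in I & r \in I] ->
    [/\ a != b, b != r & r != a] -> exists2 i, c i != a & decided i.
  move=> abrI abr; have cI := IE a b r abrI abr.
  case: abrI abr => aI bI rI [ab br ra].
  case: (pickP (fun i => (c i != a) && decided i)) => [i /andP[]|none].
    by exists i.
  have dec i : c i != a -> ~~ decided i.
    by move=> cia; have := none i; rewrite cia => /= ->.
  have lt := expected_merge_lt ab br ra (block_size_gt0 aI) (block_size_gt0 bI)
    (block_size_gt0 rI) cI dec.
  have ar : a != r by rewrite eq_sym.
  have [_] := weighted_le_max (sz _ aI) (sz _ bI) (sz _ rI) ge (merge_le _ _ ab aI bI)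
    (merge_le _ _ ar aI rI) (merge_le _ _ br bI rI) (expected_merge c ab br ra).
  by rewrite leNgt lt.
have /card_gt2P[a [b [r [[aI bI rI] [ab br ra]]]]] := c2.
have [i _ di] := some_decided a b r (And3 aI bI rI) (And3 ab br ra).
have /imsetP[i0 _ _] := aI.
have ciI : c i \in I by rewrite imset_f.
have [b' [r' [b'I r'I [ib' br' ri']]]] : exists b' r', [/\ b' \in I, r' \in I &
    [/\ c i != b', b' != r' & r' != c i]].
  have := IE a b r (And3 aI bI rI) (And3 ab br ra) i; rewrite !inE.
  by case/or3P => /eqP ->; [exists b, r|exists r, a|exists a, b].
have [j cij dj] := some_decided _ _ _ (And3 ciI b'I r'I) (And3 ib' br' ri').
have cjI : c j \in I by rewrite imset_f.
have [t [tI jt ti]] : exists t, [/\ t \in I, c j != t & t != c i].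
  have := IE _ _ _ (And3 ciI b'I r'I) (And3 ib' br' ri') j.
  rewrite !inE (negbTE cij) /=.
  case/orP => /eqP ->; [exists r'|exists b'] => //; split => //; by rewrite eq_sym.
(* A merge now leaves two blocks and is optimal, so it joins or separates [i] and [j] as [h] does.
   Yet merging [c i] with [c j] joins them, and merging [c i] with [t] separates them. *)
have bin y z w : [/\ y \in I, z \in I & w \in I] ->
    [/\ y != z, z != w & w != y] ->
    (merge_labels c y z i == merge_labels c y z j) = (tnth h i == tnth h j).
  move=> yzw yzw'; have [yI zI wI] := yzw; have [yz zw wy] := yzw'.
  have [|s cs] := @binary_labelling_ex (merge_labels c y z).
    by rewrite -ltnS card_merge // I3.
  exact: expected_binary_eq cs (merge_eq y z w yzw yzw') di dj.
have it : c i != t by rewrite eq_sym.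
have ji : c i != c j by rewrite eq_sym.
have tj : t != c j by rewrite eq_sym.
have := bin (c i) (c j) t (And3 ciI cjI tI) (And3 ji jt ti).
have := bin (c i) t (c j) (And3 ciI tI cjI) (And3 it tj cij).
rewrite /merge_labels eqxx (negbTE it) (negbTE ji) (negbTE jt) eqxx => <-.
by rewrite (negbTE ji).
Qed.

Lemma expected_overlap_le c : expected_overlap p c <= best_overlap.
Proof.
have [c2|c2] := leqP #|[set c i | i : 'I_n]%SET| 2.
  by have [s] := binary_labelling_ex c2; exact: expected_binary_le.
exact/ltW/expected_ternary_lt.
Qed.

(** At undecided indices both labels are Bayes labels. At decided ones the labels read off [c] are
    those of [h] or all swapped, and a global swap does not change the blocks. *)
Lemma expected_overlap_max c : best_overlap <= expected_overlap p c ->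
  exists2 s : n.-tuple 'I_2, (forall i a, p i a <= p i (tnth s i)) &
    forall i j, (c i == c j) = (tnth s i == tnth s j).
Proof.
move=> max; have [c2|/expected_ternary_lt] := leqP #|[set c i | i : 'I_n]%SET| 2;
  last by rewrite ltNge max.
have [s cs] := binary_labelling_ex c2.
have v01 : (ord0 : 'I_2) != ord_max by [].
have csE i j : (c i == c j) = (tnth s i == tnth s j).
  case: cs => u0 [u1 [u01 cE]]; rewrite !cE.
  by case: (ord2P (tnth s i)) => ->; case: (ord2P (tnth s j)) => -> //=;
    rewrite ?eqxx ?(negbTE u01) ?[u1 == u0]eq_sym ?(negbTE u01).
have tie i a b : ~~ decided i -> p i a <= p i b.
  have := p_bayes i; have := p_sum1 i; rewrite (sum_ord2 _ v01) /decided -leNgt.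
  have := p_h i ord0; have := p_h i ord_max.
  by case: (ord2P (tnth h i)) => ->; case: (ord2P a) => ->; case: (ord2P b) => ->; lra.
case: (pickP decided) => [i0 d0|none]; last first.
  by exists s => // i a; apply: tie; rewrite none.
have eqs j : decided j -> (tnth s i0 == tnth s j) = (tnth h i0 == tnth h j).
  by move=> dj; rewrite -csE; exact: expected_binary_eq cs max d0 dj.
have [e0|ne0] := eqVneq (tnth s i0) (tnth h i0).
  exists s => // i a; have [di|di] := boolP (decided i); last exact: tie.
  suff -> : tnth s i = tnth h i by [].
  apply/eqP; have := eqs _ di; rewrite e0.
  by case: (ord2P (tnth h i0)) => ->; case: (ord2P (tnth h i)) => ->;
    case: (ord2P (tnth s i)) => ->.
exists [tuple rev_ord (tnth s i) | i < n] => [i a|i j]; rewrite !tnth_mktuple.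
  have [di|di] := boolP (decided i); last exact: tie.
  suff -> : rev_ord (tnth s i) = tnth h i by [].
  apply/eqP; have := eqs _ di; move: ne0.
  by case: (ord2P (tnth h i0)) => ->; case: (ord2P (tnth h i)) => ->;
    case: (ord2P (tnth s i)) => ->; case: (ord2P (tnth s i0)) => ->.
by rewrite csE (inj_eq rev_ord_inj).
Qed.

End ExpectedOverlap.

(** * From labellings to partitions *)

Section Partitions.
Variables (n : nat).
Hypothesis n_gt0 : (0 < n)%N.
Implicit Types (A : set_partition n) (x s h : n.-tuple 'I_2).

Definition fiber x (v : 'I_2) : {set 'I_n} := [set i | tnth x i == v]%SET.

(** Each block is its own name; any other subset of ['I_n] is a name that is not taken. *)
Definition block_of A : 'I_n -> {set 'I_n} := finset.pblock (val A).

Lemma card_subsets : (1 < #|{: {set 'I_n}}|)%N.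
Proof.
rewrite -cardsT -powersetT card_powerset cardsT card_ord.
by rewrite -{1}(expn0 2) ltn_exp2l.
Qed.

Lemma set_partition_props A :
  [/\ finset.cover (val A) = [set: 'I_n]%SET, finset.trivIset (val A) &
      finset.set0 \notin val A].
Proof. by case: A => A /= /and3P[/eqP ? ? ?]. Qed.

Lemma block_ofP A i : block_of A i \in val A /\ i \in block_of A i.
Proof.
have [cA tA _] := set_partition_props A.
have iA : i \in finset.cover (val A) by rewrite cA inE.
by split; [exact: finset.pblock_mem|rewrite /block_of finset.mem_pblock].
Qed.

Lemma block_of_eq A i u : u \in val A -> (block_of A i == u) = (i \in u).
Proof.
move=> uA; have [cA tA _] := set_partition_props A.
apply/eqP/idP => [<-|iu]; first by have [] := block_ofP A i.
exact: finset.def_pblock.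
Qed.

Lemma block_count_block A x u v : u \in val A ->
  block_count (block_of A) x u v = #|u :&: fiber x v|%N.
Proof.
move=> uA; rewrite -sum1_card /block_count [RHS]big_mkcond /=.
by apply: eq_bigr => i _; rewrite block_of_eq // !inE; case: (_ && _).
Qed.

Lemma block_count_notin A x u v : u \notin val A ->
  block_count (block_of A) x u v = 0%N.
Proof.
move=> uA; rewrite /block_count big1 // => i _.
have [bi _] := block_ofP A i.
by have [e|//] := eqVneq (block_of A i) u; rewrite -e bi in uA.
Qed.

Lemma fiber_neq x v v' : v != v' -> fiber x v != finset.set0 ->
  fiber x v != fiber x v'.
Proof.
move=> vv /set0Pn[i iv]; apply/eqP => E; have := iv; rewrite E.
by move: iv; rewrite !inE => /eqP ->; rewrite (negbTE vv).
Qed.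

(** Matchings of blocks with nonempty fibers are exchanged with ordered pairs of distinct names. The
    two sides differ only by edges that carry no overlap. *)
Lemma max_overlap_fibers A x :
  max_overlap (val A) (fibers x) = label_overlap (block_of A) x.
Proof.
have v01 : (ord0 : 'I_2) != ord_max by [].
have v10 : (ord_max : 'I_2) != ord0 by [].
have [cA tA A0] := set_partition_props A.
apply/eqP; rewrite eqn_leq; apply/andP; split.
  apply/bigmax_leqP => M /and3P[/fintype.subsetP MX /forall_inP M1 /forall_inP M2].
  have inj1 e e' : e \in M -> e' \in M -> e.1 = e'.1 -> e = e'.
    move=> eM e'M E; apply/eqP.
    by move: (M1 _ eM) => /forall_inP/(_ _ e'M)/implyP; apply; rewrite E.
  have inj2 e e' : e \in M -> e' \in M -> e.2 = e'.2 -> e = e'.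
    move=> eM e'M E; apply/eqP.
    by move: (M2 _ eM) => /forall_inP/(_ _ e'M)/implyP; apply; rewrite E.
  have ME e : e \in M -> [/\ e.1 \in val A, e.2 != finset.set0 &
      (e.2 == fiber x ord0) || (e.2 == fiber x ord_max)].
    move=> /MX; rewrite !inE => /andP[-> /andP[-> /imsetP[v _ ->]]].
    by split=> //; case: (ord2P v) => ->; rewrite /fiber eqxx ?orbT.
  have -> : (\sum_(e in M) #|e.1 :&: e.2| =
      \sum_(e in M | e.2 == fiber x ord0) #|e.1 :&: e.2| +
      \sum_(e in M | e.2 == fiber x ord_max) #|e.1 :&: e.2|)%N.
    rewrite (bigID (fun e => e.2 == fiber x ord0)) /=; congr addn.
    apply: eq_bigl => e; have [eM|//] := boolP (e \in M); rewrite !andTb.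
    have [_ ne eE] := ME _ eM; have [e2|e2] := eqVneq e.2 (fiber x ord0).
      by rewrite e2 in ne *; rewrite (negbTE (fiber_neq v01 ne)).
    by move: eE; rewrite (negbTE e2) /= => ->.
  (* Each fiber lies on at most one edge, so its share of the sum is a single block count or
     zero. *)
  have one v : (exists2 u, u \in val A & exists2 e, e \in M & e = (u, fiber x v) /\
      \sum_(e in M | e.2 == fiber x v) #|e.1 :&: e.2| =
        block_count (block_of A) x u v) \/
      (\sum_(e in M | e.2 == fiber x v) #|e.1 :&: e.2| = 0)%N.
    have [e /andP[eM /eqP e2]|none] := pickP [pred e | (e \in M) && (e.2 == fiber x v)].
      left; have [e1A _ _] := ME _ eM; exists e.1 => //; exists e => //.
      split; first by rewrite -e2 -surjective_pairing.
      rewrite block_count_block // -e2 (big_pred1 e) // => e' /=.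
      apply/andP/eqP => [[e'M /eqP e'2]|->]; last by rewrite eM.
      exact: inj2.
    by right; apply: big_pred0.
  case: (one ord0) => [[u uA [e eM [eE ->]]]|->];
    case: (one ord_max) => [[u' uA' [e' eM' [eE' ->]]]|->].
  - apply: label_overlap_ge => //; apply/eqP => uu.
    have /inj1 -/(_ _ eM') := eM; rewrite eE eE' => /(_ uu)[_ C01].
    have [_ C0 _] := ME _ eM; rewrite eE /= in C0.
    by have := fiber_neq v01 C0; rewrite C01 eqxx.
  (* The empty set is never a block, so it serves as the name paired with the unmatched fiber. *)
  - have uu : u != finset.set0 by apply: contraTneq uA => ->.
    by apply: leq_trans (label_overlap_ge _ _ uu v01); rewrite leq_add2l.
  - have uu : finset.set0 != u' by apply: contraTneq uA' => <-.
    by apply: leq_trans (label_overlap_ge _ _ uu v01); rewrite leq_add2r.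
  - by [].
have [u [u' [uu ->]]] := label_overlap_ex card_subsets (block_of A) x.
pose ok (e : {set 'I_n} * {set 'I_n}) := (e.1 \in val A) && (e.2 != finset.set0).
pose e0 := (u, fiber x ord0); pose e1 := (u', fiber x ord_max).
(* Edges with a name that is not a block, or with an empty fiber, are dropped; they contribute
   zero. *)
pose M := [set e in [set e0; e1] | ok e]%SET.
have e01 : e0 != e1 by rewrite xpair_eqE negb_and uu.
have sumM : (\sum_(e in M) #|e.1 :&: e.2| =
    block_count (block_of A) x u ord0 + block_count (block_of A) x u' ord_max)%N.
  have val1 w v : (if ok (w, fiber x v) then #|w :&: fiber x v| else 0)%N =
      block_count (block_of A) x w v.
    rewrite /ok /=; have [wA|wA] := boolP (w \in val A); last first.
      by rewrite block_count_notin.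
    rewrite block_count_block //=; case: eqP => //= ->.
    by rewrite finset.setI0 cards0.
  rewrite -!val1 -/e0 -/e1.
  rewrite (eq_bigl (fun e => (e \in [set e0; e1]%SET) && ok e)); last first.
    by move=> e; rewrite inE.
  by rewrite big_mkcondr /= big_setU1 ?inE //= big_set1.
rewrite -sumM; apply: (leq_bigmax_cond M (F := fun M : {set _} =>
   \sum_(e in M) #|e.1 :&: e.2|)%N).
have okM e : e \in M -> ok e /\ (e = e0 \/ e = e1).
  by rewrite !inE => /andP[/orP[] /eqP -> ->]; split => //; [left|right].
have neq : fiber x ord0 != finset.set0 -> fiber x ord0 != fiber x ord_max.
  exact: fiber_neq.
apply/and3P; split.
- apply/fintype.subsetP => e /okM[/andP[e1A e20] eE]; rewrite !inE e1A e20 /=.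
  by case: eE => ->; apply/imsetP; [exists ord0|exists ord_max].
- apply/forall_inP => e /okM[_ eE]; apply/forall_inP => e' /okM[_ eE'].
  by apply/implyP; case: eE => ->; case: eE' => -> //=;
    rewrite ?[u' == u]eq_sym (negbTE uu).
- apply/forall_inP => e /okM[/andP[_ ok2] eE].
  apply/forall_inP => e' /okM[/andP[_ ok2'] eE'].
  apply/implyP; case: eE ok2 => -> /= ok2; case: eE' ok2' => -> //= ok2'.
  + by rewrite (negbTE (neq ok2)).
  + by rewrite eq_sym (negbTE (neq ok2')).
Qed.

Lemma set_partition_fibers A s :
  (forall i j, (block_of A i == block_of A j) = (tnth s i == tnth s j)) ->
  A = pi_n s.
Proof.
move=> H; apply: val_inj => /=.
have bE i : block_of A i = [set j | tnth s j == tnth s i]%SET.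
  apply/setP => j; rewrite inE -H block_of_eq //.
  by have [] := block_ofP A i.
have [cA tA A0] := set_partition_props A.
apply/setP => u; rewrite !inE; apply/idP/andP.
  move=> uA; have u0 : u != finset.set0 by apply: contraTneq uA => ->.
  split=> //; have [i iu] := set0Pn _ u0.
  have := iu; rewrite -(block_of_eq i uA) => /eqP <-.
  by rewrite bE; apply/imsetP; exists (tnth s i).
case=> /set0Pn[i iu] /imsetP[v _ uE]; move: iu; rewrite uE inE => /eqP <-.
by rewrite -bE; have [] := block_ofP A i.
Qed.

(** A fiber may be empty and is then only a name. As n > 0, the two fibers are not both empty, hence
    are distinct names. *)
Lemma binary_fibers h : binary_labelling (block_of (pi_n h)) h.
Proof.
have bE i : block_of (pi_n h) i = fiber h (tnth h i).
  apply/eqP; rewrite block_of_eq /= !inE ?eqxx //.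
  apply/andP; split; last by apply/imsetP; exists (tnth h i).
  by apply/set0Pn; exists i; rewrite inE.
exists (fiber h ord0), (fiber h ord_max); split; last first.
  by move=> i; rewrite bE; case: (ord2P (tnth h i)) => ->.
pose i0 := Ordinal n_gt0; apply/eqP => /setP/(_ i0); rewrite !inE.
by case: (ord2P (tnth h i0)) => ->.
Qed.

End Partitions.

(** * Expected loss of a partition under independent labels *)

Section BayesPartition.
Variables (R : realType) (n : nat).
Hypothesis n_gt0 : (0 < n)%N.
Variables (p : 'I_n -> 'I_2 -> R) (h : n.-tuple 'I_2).
Hypothesis p_ge0 : forall i a, 0 <= p i a.
Hypothesis p_sum1 : forall i, \sum_a p i a = 1.
Hypothesis p_h : forall i a, p i a <= p i (tnth h i).

Definition expected_loss (A : set_partition n) : R :=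
  \sum_(x : n.-tuple 'I_2) loss R A (pi_n x) * \prod_(i < n) p i (tnth x i).

Lemma expected_lossE A :
  expected_loss A = 1 - expected_overlap p (block_of A) / n%:R.
Proof.
rewrite /expected_loss /expected_overlap -[X in _ = X - _](sum_prob_tuple p_sum1).
rewrite big_distrl /= -sumrB; apply: eq_bigr => x _.
by rewrite /loss max_overlap_fibers //= mulrBl mul1r mulrC mulrA.
Qed.

Lemma expected_loss_pi_n_le A : expected_loss (pi_n h) <= expected_loss A.
Proof.
rewrite !expected_lossE lerD2l lerN2 ler_pM2r ?invr_gt0 ?ltr0n //.
rewrite (expected_binary (card_subsets n_gt0) p_sum1 (binary_fibers n_gt0 h)).
exact: (expected_overlap_le (card_subsets n_gt0) p_ge0 p_sum1 p_h).
Qed.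

Lemma expected_loss_min A : expected_loss A <= expected_loss (pi_n h) ->
  exists2 s, (forall i a, p i a <= p i (tnth s i)) & A = pi_n s.
Proof.
rewrite !expected_lossE lerD2l lerN2 ler_pM2r ?invr_gt0 ?ltr0n //.
rewrite (expected_binary (card_subsets n_gt0) p_sum1 (binary_fibers n_gt0 h)).
move=> /(expected_overlap_max (card_subsets n_gt0) p_ge0 p_sum1 p_h)[s ps sE].
by exists s => //; exact: set_partition_fibers.
Qed.

End BayesPartition.

(** * Measures with densities and conditional expectations *)

Section Density.
Context d (T : measurableType d) (R : realType).
Variable mu : {finite_measure set T -> \bar R}.

(** The proofs [Z0] and [iZ] are arguments so that the finite measure structure can be attached to
    the definition. *)
Definition density_measure (Z : T -> R) (Z0 : forall w, 0 <= Z w)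
    (iZ : mu.-integrable setT (EFin \o Z)) : set T -> \bar R :=
  fun A => (\int[mu]_(w in A) (Z w)%:E)%E.

Variables (Z : T -> R) (Z0 : forall w, 0 <= Z w).
Hypothesis iZ : mu.-integrable setT (EFin \o Z).

Local Notation nu := (density_measure Z0 iZ).

Let nu0 : nu set0 = 0%E.
Proof. by rewrite /density_measure integral_set0. Qed.

Let nu_ge0 A : (0 <= nu A)%E.
Proof. by apply: integral_ge0 => w _; rewrite lee_fin. Qed.

Let nu_sigma_additive : semi_sigma_additive nu.
Proof.
apply: (@semi_sigma_additive_nng_induced _ _ _ mu (EFin \o Z)).
  exact: measurable_int iZ.
by move=> w /=; rewrite lee_fin.
Qed.

HB.instance Definition _ := isMeasure.Build _ _ _ nu nu0 nu_ge0 nu_sigma_additive.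

Let nu_fin : fin_num_fun nu.
Proof.
move=> A mA; apply: integrable_fin_num => //.
exact: integrableS iZ.
Qed.

HB.instance Definition _ := Measure_isFinite.Build _ _ _ nu nu_fin.

(** Change of variables for the Radon-Nikodym derivative of [nu], which equals [Z] almost everywhere
    as both have the same integrals. *)
Lemma integral_density (A : set T) (g : T -> \bar R) : measurable A ->
  measurable_fun A g -> (forall w, 0 <= g w)%E ->
  (\int[nu]_(w in A) g w = \int[mu]_(w in A) (g w * (Z w)%:E))%E.
Proof.
move=> mA mg g0.
have numu : nu `<< mu.
  apply/null_content_dominatesP => B mB muB0.
  by apply: null_set_integral => //; apply: measurable_funTS; exact: measurable_int iZ.
rewrite -(Radon_Nikodym_SigmaFinite.change_of_variables numu) //.
have mRN := measurable_int _ (Radon_Nikodym_SigmaFinite.f_integrable numu).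
have mZ := measurable_int _ iZ.
apply: ae_eq_integral => //.
- by apply: emeasurable_funM => //; exact: measurable_funTS.
- by apply: emeasurable_funM => //; exact: measurable_funTS.
apply: ae_eqe_mul2l; apply/ae_eq_sym.
apply: (@integral_ae_eq _ _ _ mu _ mA _ (EFin \o Z)).
- exact: integrableS iZ.
- exact: measurable_funTS.
- move=> B BA mB; rewrite -(Radon_Nikodym_SigmaFinite.f_integral numu) //.
Qed.

End Density.

Section FiniteLaw.
Context d d' (T : measurableType d) (T' : measurableType d') (R : realType).
Variable mu : {finite_measure set T -> \bar R}.

Definition law (Y : T -> T') (mY : measurable_fun setT Y) : set T' -> \bar R :=
  pushforward mu Y.

Variables (Y : T -> T').
Hypothesis mY : measurable_fun setT Y.

Let law0 : law mY set0 = 0%E.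
Proof. by rewrite /law /pushforward preimage_set0 measure0. Qed.

Let law_ge0 A : (0 <= law mY A)%E.
Proof. exact: measure_ge0. Qed.

Let law_sigma_additive : semi_sigma_additive (law mY).
Proof. exact: (@measure_semi_sigma_additive _ _ _ (pushforward mu Y)). Qed.

HB.instance Definition _ :=
  isMeasure.Build _ _ _ (law mY) law0 law_ge0 law_sigma_additive.

Let law_fin : fin_num_fun (law mY).
Proof.
move=> A mA; rewrite /law /pushforward fin_num_measure //.
by rewrite -[X in measurable X]setTI; exact: mY.
Qed.

HB.instance Definition _ := Measure_isFinite.Build _ _ _ (law mY) law_fin.

(** The hypothesis on [lam] says that it is the image under [Y] of the measure with density [Z];
    both sides integrate [g] against that image. *)
Lemma integral_law_density (Z : T -> R) (lam : {measure set T' -> \bar R})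
    (g : T' -> R) (B : set T') :
  (forall w, 0 <= Z w) -> mu.-integrable setT (EFin \o Z) ->
  (forall B, measurable B ->
     (\int[mu]_(w in Y @^-1` B) (Z w)%:E = lam B)%E) ->
  measurable_fun setT g -> (forall y, 0 <= g y) -> measurable B ->
  (\int[mu]_(w in Y @^-1` B) (g (Y w) * Z w)%:E = \int[lam]_(y in B) (g y)%:E)%E.
Proof.
move=> Z0 iZ Zlam mg g0 mB.
have mYB : measurable (Y @^-1` B) by rewrite -[X in measurable X]setTI; exact: mY.
have mgE : measurable_fun setT (EFin \o g) by exact/measurable_EFinP.
under [LHS]eq_integral do rewrite EFinM.
rewrite -(integral_density Z0 iZ (g := fun w => (g (Y w))%:E)) //; last 2 first.
- by apply: measurable_funTS; exact: (measurableT_comp mgE mY).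
- by move=> w; rewrite lee_fin.
rewrite -(@eq_measure_integral _ _ _ B lam (pushforward (density_measure Z0 iZ) Y)).
  rewrite ge0_integral_pushforward //; first exact: measurable_funTS.
  by move=> y _; rewrite lee_fin.
by move=> C mC _; rewrite -Zlam.
Qed.

End FiniteLaw.

(** * Posterior weights of two classes *)

Section Posterior.
Context d (T : measurableType d) (R : realType).
Variables (m m0 m1 : {finite_measure set T -> \bar R}).
Hypothesis mE : forall B, measurable B -> m B = (m0 B + m1 B)%E.

Lemma posterior_ex : exists p : T -> R, [/\ measurable_fun setT p,
  forall y, 0 <= p y <= 1,
  forall B, measurable B -> (\int[m]_(y in B) (p y)%:E = m0 B)%E &
  forall B, measurable B -> (\int[m]_(y in B) (1 - p y)%:E = m1 B)%E].
Proof.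
have le0 B : measurable B -> (m0 B <= m B)%E by move=> mB; rewrite mE // leeDl.
have le1 B : measurable B -> (m1 B <= m B)%E by move=> mB; rewrite mE // leeDr.
have dom (k : {finite_measure set T -> \bar R}) :
    (forall B, measurable B -> (k B <= m B)%E) -> k `<< m.
  move=> le; apply/null_content_dominatesP => B mB mB0.
  by apply/eqP; rewrite eq_le measure_ge0 andbT -mB0 le.
have [f0 [f00 f0fin if0 f0E]] := radon_nikodym_sigma_finite (dom m0 le0).
have [f1 [f10 f1fin if1 f1E]] := radon_nikodym_sigma_finite (dom m1 le1).
have f01 : ae_eq m setT (f0 \+ f1)%E (cst 1%E).
  apply: integral_ae_eq => //; first exact: integrableD.
  move=> B _ mB; rewrite integralD //; [|exact: integrableS if0|exact: integrableS if1].
  by rewrite -f0E // -f1E // -mE // integral_cst // mul1e.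
(* Truncating the derivative of [m0] at 1 gives bounds valid everywhere. It changes the derivative
   only on a null set, the two derivatives being nonnegative with sum 1 almost everywhere. *)
pose p y := Num.min 1 (fine (f0 y)).
have mf0 := measurable_int _ if0.
have mp : measurable_fun setT p.
  apply: measurable_minr => //.
  apply/measurable_EFinP; rewrite (_ : EFin \o _ = f0) //.
  by apply/funext => y /=; rewrite fineK.
have p0 y : 0 <= p y by rewrite /p le_min ler01 fine_ge0.
have p1 y : p y <= 1 by rewrite /p ge_min lexx.
have pf0 : ae_eq m setT (EFin \o p) f0.
  apply: filterS f01 => y /(_ I) /= f01y _; rewrite /p.
  have := f10 y; have := f0fin y; have := f1fin y; move: f01y.
  case: (f0 y) => // a; case: (f1 y) => // b /= [ab] _ _; rewrite lee_fin => b0.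
  by rewrite min_r //; lra.
have mB_fin B : measurable B -> (m B < +oo)%E.
  by move=> mB; rewrite ltey_eq fin_num_measure.
have ip B : measurable B -> m.-integrable B (EFin \o p).
  move=> mB; apply: measurable_bounded_integrable => //;
    [exact: mB_fin|exact: measurable_funTS|].
  exists 1; split => // M M1 y _ /=; rewrite ger0_norm //; apply: le_trans (ltW M1).
  exact: p1.
have Ep B : measurable B -> (\int[m]_(y in B) (p y)%:E = m0 B)%E.
  move=> mB; rewrite f0E //; apply: ae_eq_integral => //.
  - by apply/measurable_EFinP; exact: measurable_funTS.
  - exact: measurable_funTS.
  - exact: ae_eq_subset pf0.
exists p; split=> // [y|B mB]; first by rewrite p0 p1.
under eq_integral do rewrite EFinB.
rewrite integralB //; [|exact: finite_measure_integrable_cst|exact: ip].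
rewrite Ep // integral_cst // mul1e.
transitivity (m0 B + m1 B - m0 B)%E; first by congr (_ - _)%E; exact: mE.
rewrite addeAC subee ?add0e //.
exact: fin_num_measure.
Qed.

End Posterior.

(** * Versions of conditional expectations *)

Section ConditionalExpectation.
Context (R : realType) d (Omega : measurableType d) (P : probability Omega R).

Lemma bounded_integrable (Z : Omega -> R) M : measurable_fun setT Z ->
  (forall w, 0 <= Z w <= M) -> P.-integrable setT (EFin \o Z).
Proof.
move=> mZ ZM; apply: measurable_bounded_integrable => //.
  by rewrite [ltLHS]probability_setT ltry.
exists M; split => [|N /ltW MN w _ /=].
  by have /andP[Z0 ZM'] := ZM point; exact: ger0_real (le_trans Z0 ZM').
by have /andP[Z0 ZM'] := ZM w; rewrite ger0_norm // (le_trans ZM').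
Qed.

Variable G : set (set Omega).
Hypotheses (sG : sigma_algebra setT G) (GM : G `<=` measurable).

(** The event [Z2 < Z1] belongs to [G], so both versions have the same integral on it; the positive
    difference then vanishes almost everywhere there. *)
Lemma condexp_le W Z1 Z2 : is_condexp P G W Z1 -> is_condexp P G W Z2 ->
  {ae P, forall w, Z1 w <= Z2 w}.
Proof.
move=> [m1 i1 e1] [m2 i2 e2].
pose A := [set w | Z2 w < Z1 w].
have GA : G A.
  pose M := g_sigma_algebraType G.
  have GE : @measurable _ M = G by exact: measurable_g_measurableTypeE.
  have mZ1 : measurable_fun setT (Z1 : M -> R).
    by move=> _ B mB; rewrite setTI GE; exact: m1.
  have mZ2 : measurable_fun setT (Z2 : M -> R).
    by move=> _ B mB; rewrite setTI GE; exact: m2.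
  have := measurable_fun_ltr mZ2 mZ1.
  by move=> /(_ measurableT [set true] I); rewrite setTI GE.
have mA := GM GA.
have i1A := integrableS measurableT mA (@subsetT _ _) i1.
have i2A := integrableS measurableT mA (@subsetT _ _) i2.
have : (\int[P]_(w in A) `|(Z1 w - Z2 w)%:E| = 0)%E.
  transitivity (\int[P]_(w in A) ((Z1 w)%:E - (Z2 w)%:E))%E.
    apply: eq_integral => w /set_mem Aw.
    by rewrite -EFinB gee0_abs // lee_fin subr_ge0 ltW.
  rewrite integralB // -[X in (X - _)%E]/(\int[P]_(w in A) (Z1 w)%:E)%E e1 // -e2 //.
  rewrite subee //; exact: integrable_fin_num i2A.
move/ae_eq_integral_abs => /(_ mA) H.
have {H} : ae_eq P A (fun w => (Z1 w - Z2 w)%:E) (cst 0%E).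
  apply: H; apply/measurable_EFinP/measurable_funB.
    by apply/measurable_EFinP; exact: measurable_int i1A.
  by apply/measurable_EFinP; exact: measurable_int i2A.
apply: filterS => w /= H; rewrite leNgt; apply/negP => lt.
by have [] := H lt => /eqP; rewrite subr_eq0 gt_eqF.
Qed.

Lemma condexp_ae W Z : is_condexp P G W Z ->
  {ae P, forall w, condexp P G W w = Z w}.
Proof.
(* Since a version exists, the chosen one is a version and not the default value. *)
move=> WZ; have WC : is_condexp P G W (condexp P G W).
  by apply: (@xgetPex _ (fun=> 0) [set Z | is_condexp P G W Z]); exists Z.
apply: filterS2 (condexp_le WC WZ) (condexp_le WZ WC) => w le ge.
by apply/eqP; rewrite eq_le le ge.
Qed.

End ConditionalExpectation.

(** * Law of independent labels and of their observations *)

Section IndependentLabels.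
Context (R : realType) (T : ptopologicalType).
Context (L : {measure set (borel T) -> \bar R}) (theta : hmm_param L 2).
Hypothesis htheta : Theta_ind theta.
Context d (Omega : measurableType d) (P : probability Omega R).
Context (X : nat -> Omega -> 'I_2) (Y : nat -> Omega -> borel T).
Hypothesis hXY : hmm_law theta P X Y.

Lemma measurable_label i a : measurable [set w | X i w = a].
Proof. by case: hXY => mX _ _ _; exact: (mX i [set a]). Qed.

Lemma measurable_obs i : measurable_fun setT (Y i).
Proof. by case: hXY => _ mY _ _; exact: mY. Qed.

Definition label_obs_prob (a : 'I_2) (B : set (borel T)) : R :=
  nu theta a * \int[L]_(y in B) f theta a y.

Lemma prob_labels_le (x : nat -> 'I_2) k :
  P [set w | forall i, (i <= k)%N -> X i w = x i] =
  (\prod_(i < k.+1) nu theta (x i))%:E.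
Proof.
have [_ _ [init step] _] := hXY.
elim: k => [|k IH].
  rewrite big_ord_recl big_ord0 mulr1 -init; congr (P _); apply/seteqP.
  by split=> w /= H; [exact: H|case].
by rewrite step IH htheta -EFinM [in RHS]big_ord_recr.
Qed.

Lemma prob_labels n (x : 'I_n -> 'I_2) :
  P [set w | forall i : 'I_n, X i w = x i] = (\prod_i nu theta (x i))%:E.
Proof.
case: n x => [|k] x.
  rewrite big_ord0 -(@probability_setT _ _ _ P); congr (P _).
  by apply/seteqP; split=> // w _ [].
rewrite (eq_bigr (fun i : 'I_k.+1 => nu theta (x (inord i)))); last first.
  by move=> i _; rewrite inord_val.
rewrite -(prob_labels_le (fun i => x (inord i))); congr (P _); apply/seteqP.
split=> w /= H i; last by rewrite H ?inord_val // -ltnS.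
by move=> ik; rewrite -H inordK.
Qed.

(** The conditional probability of the emissions given the labels is constant on the event fixing
    the first [n] labels; it is integrated over that event. *)
Lemma prob_labels_obs n (x : 'I_n -> 'I_2) (B : 'I_n -> set (borel T)) :
  (forall i, measurable (B i)) ->
  P [set w | forall i : 'I_n, X i w = x i /\ B i (Y i w)] =
  (\prod_i label_obs_prob (x i) (B i))%:E.
Proof.
move=> mB; pose A := [set w | forall i : 'I_n, X i w = x i].
pose E := [set w | forall i : 'I_n, B i (Y i w)].
have AE : A = \bigcap_(i in [set: 'I_n]) [set w | X i w = x i].
  by apply/seteqP; split=> w H i; [move=> _; exact: H|exact: (H i I)].
have mA : measurable A.
  by rewrite AE; apply: fin_bigcap_measurable => // i _; exact: measurable_label.
have mE : measurable E.
  have -> : E = \bigcap_(i in [set: 'I_n]) (Y i @^-1` B i).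
    by apply/seteqP; split=> w H i; [move=> _; exact: H|exact: (H i I)].
  apply: fin_bigcap_measurable => // i _.
  by rewrite -[X in measurable X]setTI; exact: measurable_obs.
have sA : sigma_labels X A.
  rewrite AE /sigma_labels; set G := (X in <<s X >>).
  apply: (@fin_bigcap_measurable _ (g_sigma_algebraType G)) => // i _.
  apply: sub_sigma_algebra; exists i => //; exists [set x i] => //.
  by rewrite setTI.
have [_ _ _ emis] := hXY.
have [_ _ /(_ A sA)] := emis n B mB.
rewrite integral_indic // => H.
transitivity (P (E `&` A)).
  congr (P _); apply/seteqP; split => w /=.
    by move=> K; split=> i; have [] := K i.
  by move=> [K1 K2] i; split.
rewrite -H (eq_integral (cst (\prod_(i < n) \int[L]_(y in B i) f theta (x i) y)%:E)).
  rewrite integral_cst //; transitivity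
      ((\prod_(i < n) \int[L]_(y in B i) f theta (x i) y)%:E *
       (\prod_i nu theta (x i))%:E)%E.
    by congr (_ * _)%E; exact: prob_labels.
  rewrite -EFinM -big_split /=; congr EFin.
  by apply: eq_bigr => i _; rewrite mulrC.
by move=> w /set_mem Aw /=; congr EFin; apply: eq_bigr => i _; rewrite Aw.
Qed.

Lemma prob_label_obs a B : measurable B ->
  P ([set w | X 0 w = a] `&` Y 0 @^-1` B) = (label_obs_prob a B)%:E.
Proof.
move=> mB; have := @prob_labels_obs 1 (fun=> a) (fun=> B) (fun=> mB).
rewrite big_ord_recl big_ord0 mulr1 => <-; congr (P _); apply/seteqP.
by split=> w /= => [[H1 H2] i|/(_ ord0)//]; rewrite (ord1 i).
Qed.

Definition obs_law := law P (measurable_obs 0).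

Lemma obs_lawE B : measurable B ->
  obs_law B = (label_obs_prob ord0 B + label_obs_prob ord_max B)%:E.
Proof.
move=> mB; rewrite EFinD -!prob_label_obs // -measureU.
- congr (P _); apply/seteqP; split => w /=; last by case=> -[].
  by move=> Bw; have [->|->] := ord2P (X 0 w); [left|right].
- apply: measurableI; first exact: measurable_label.
  by rewrite -[X in measurable X]setTI; exact: measurable_obs.
- apply: measurableI; first exact: measurable_label.
  by rewrite -[X in measurable X]setTI; exact: measurable_obs.
- by apply/seteqP; split=> w //= [[-> _] []].
Qed.

(** The law of the first observation is split according to its label. The same weights serve at
    every index, the pairs of label and observation being identically distributed. *)
Lemma posterior_label_ex : exists post : 'I_2 -> borel T -> R,
  [/\ forall a, measurable_fun setT (post a),
      forall a y, 0 <= post a y,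
      forall y, \sum_a post a y = 1 &
      forall a B, measurable B ->
        (\int[obs_law]_(y in B) (post a y)%:E = (label_obs_prob a B)%:E)%E].
Proof.
have Z0 a w : 0 <= \1_[set w | X 0 w = a] w :> R by rewrite indicE ler0n.
have iZ a : P.-integrable setT (EFin \o \1_[set w | X 0 w = a]).
  by apply: integrable_indic; exact: measurable_label.
pose m a := law (density_measure (Z0 a) (iZ a)) (measurable_obs 0).
have mE a B : measurable B -> m a B = (label_obs_prob a B)%:E.
  move=> mB; have mYB : measurable (Y 0 @^-1` B).
    by rewrite -[X in measurable X]setTI; exact: measurable_obs.
  transitivity (\int[P]_(w in Y 0 @^-1` B) (\1_[set w | X 0 w = a] w)%:E)%E => //.
  rewrite integral_indic //.
    exact: prob_label_obs.
  exact: measurable_label.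
have [|p [mp p01 p0E p1E]] :=
    @posterior_ex _ _ _ (law P (measurable_obs 0)) (m ord0) (m ord_max).
  move=> B mB; apply: etrans (obs_lawE mB) _; rewrite EFinD.
  by congr (_ + _)%E; exact/esym/mE.
exists (fun a y => if a == ord0 then p y else 1 - p y); split.
- by move=> a; case: (a == ord0) => //; exact: measurable_funB.
- by move=> a y; have := p01 y; case: (a == ord0); lra.
- by move=> y; rewrite (@sum_ord2 _ _ ord0 ord_max) //=; ring.
- move=> a B mB; apply: etrans (mE _ _ mB).
  by have [->|->] := ord2P a; [exact: p0E|exact: p1E].
Qed.

End IndependentLabels.

(** * Posterior law of the labels *)

Lemma prod_indic (R : realType) (Omega : Type) n (A : 'I_n -> set Omega) w :
  \prod_(i < n) (\1_(A i) w : R) = \1_[set w | forall i, A i w] w.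
Proof.
rewrite [RHS]indicE; have [/set_mem H|/negP H] := boolP (w \in [set w | forall i, A i w]).
  by rewrite big1 // => i _; rewrite indicE mem_set.
have [i Ai] : exists i, ~ A i w.
  by apply/existsNP => K; apply: H; rewrite inE.
by rewrite (bigD1 i) //= indicE memNset // mul0r.
Qed.

Section JointLaw.
Context (R : realType) (T : ptopologicalType).
Context (L : {measure set (borel T) -> \bar R}) (theta : hmm_param L 2).
Hypothesis htheta : Theta_ind theta.
Context d (Omega : measurableType d) (P : probability Omega R).
Context (X : nat -> Omega -> 'I_2) (Y : nat -> Omega -> borel T).
Hypothesis hXY : hmm_law theta P X Y.
Variable post : 'I_2 -> borel T -> R.
Hypothesis mpost : forall a, measurable_fun setT (post a).
Hypothesis post_ge0 : forall a y, 0 <= post a y.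
Hypothesis post_sum1 : forall y, \sum_a post a y = 1.
Hypothesis postE : forall a B, measurable B ->
  (\int[obs_law hXY]_(y in B) (post a y)%:E = (label_obs_prob theta a B)%:E)%E.

Let mX := measurable_label hXY.
Let mY := measurable_obs hXY.

Let mYB i B : measurable B -> measurable (Y i @^-1` B).
Proof. by move=> mB; rewrite -[X in measurable X]setTI; exact: mY. Qed.

Lemma indic_label i a w : \1_[set w | X i w = a] w = (X i w == a)%:R :> R.
Proof.
by rewrite indicE; congr ((nat_of_bool _)%:R); apply/idP/eqP; rewrite inE.
Qed.

Lemma post_le1 a y : post a y <= 1.
Proof.
rewrite -(post_sum1 y) (bigD1 a) //= lerDl; exact: sumr_ge0.
Qed.

Lemma label_obs_prob_ge0 a B : 0 <= label_obs_prob theta a B.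
Proof.
by rewrite mulr_ge0 ?nu_ge0 // Rintegral_ge0 // => y _; exact: f_ge0.
Qed.

(** Interpolates between label indicators, at j = 0, and posterior weights, at j = n; the indices
    below [j] have been replaced. *)
Definition hybrid n (x : 'I_n -> 'I_2) (B : 'I_n -> set (borel T)) j
    (i : 'I_n) w : R :=
  (if (i < j)%N then post (x i) (Y i w) else \1_[set w | X i w = x i] w) *
  \1_(Y i @^-1` B i) w.

Lemma measurable_hybrid n (x : 'I_n -> 'I_2) (B : 'I_n -> set (borel T)) j i :
  measurable (B i) -> measurable_fun setT (hybrid x B j i).
Proof.
move=> mB; apply: measurable_funM; last by apply: measurable_indic; exact: mYB.
case: (i < j)%N; last by apply: measurable_indic; exact: mX.
exact: (measurableT_comp (mpost (x i)) (mY i)).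
Qed.

Lemma hybrid_bound n (x : 'I_n -> 'I_2) (B : 'I_n -> set (borel T)) j i w :
  0 <= hybrid x B j i w <= 1.
Proof.
have i01 (A : set Omega) : 0 <= (\1_A w : R) <= 1.
  by rewrite indicE; case: (_ \in _); rewrite ?lexx ?ler01.
have /andP[a0 a1] := i01 (Y i @^-1` B i).
rewrite /hybrid; case: (i < j)%N; last first.
  by have /andP[b0 b1] := i01 [set w | X i w = x i]; rewrite mulr_ge0 // mulr_ile1.
by rewrite mulr_ge0 // mulr_ile1 // post_le1.
Qed.

(** Replacing the factor of index [j] leaves the integral unchanged: under the measure weighted by
    the other factors, [Y j] has a multiple of the observation law, against which the posterior
    weight integrates to the joint probability. *)
Lemma integral_hybrid n (x : 'I_n -> 'I_2) (B : 'I_n -> set (borel T)) j :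
  (forall i, measurable (B i)) -> (j <= n)%N ->
  (\int[P]_w (\prod_i hybrid x B j i w)%:E =
   (\prod_i label_obs_prob theta (x i) (B i))%:E)%E.
Proof.
elim: j x B => [|j IH] x B mB jn.
  rewrite -(prob_labels_obs htheta hXY) //.
  have mE : measurable [set w | forall i : 'I_n, X i w = x i /\ B i (Y i w)].
    have -> : [set w | forall i : 'I_n, X i w = x i /\ B i (Y i w)] =
        \bigcap_(i in [set: 'I_n]) ([set w | X i w = x i] `&` Y i @^-1` B i).
      by apply/seteqP; split=> w H i; [move=> _; exact: H|exact: (H i I)].
    by apply: fin_bigcap_measurable => // i _; apply: measurableI; [exact: mX|exact: mYB].
  rewrite -[in RHS](setIT [set w | _]) -integral_indic //; apply: eq_integral => w _.
  rewrite -prod_indic; congr EFin; apply: eq_bigr => i _.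
  by rewrite /hybrid ltn0 -[LHS]/((_ \* _) w) -indicI.
pose jo := Ordinal jn.
pose Z w := \prod_(i < n | i != jo) hybrid x B j i w.
have Z01 w : 0 <= Z w <= 1.
  rewrite /Z; apply: (big_ind (fun z => 0 <= z <= 1)); first by rewrite ler01 lexx.
    by move=> a b /andP[a0 a1] /andP[b0 b1]; rewrite mulr_ge0 // mulr_ile1.
  by move=> i _; exact: hybrid_bound.
have Z0 w : 0 <= Z w by have /andP[] := Z01 w.
have mZ : measurable_fun setT Z.
  rewrite /Z; under eq_fun do rewrite big_mkcond.
  apply: measurable_prod => i _; case: (i != jo) => //.
  exact: measurable_hybrid.
have iZ := bounded_integrable P mZ Z01.
pose c := \prod_(i < n | i != jo) label_obs_prob theta (x i) (B i).
have c0 : 0 <= c by apply: prodr_ge0 => i _; exact: label_obs_prob_ge0.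
(* The induction hypothesis is used with the label and the set of index [j] replaced by arbitrary
   [a] and [B']. *)
have Zlabel a B' : measurable B' ->
    (\int[P]_(w in Y j @^-1` B') (Z w * \1_[set w | X j w = a] w)%:E =
     (c * label_obs_prob theta a B')%:E)%E.
  move=> mB'; pose x' i := if i == jo then a else x i.
  pose B2 i := if i == jo then B' else B i.
  have mB2 i : measurable (B2 i) by rewrite /B2; case: (i == jo).
  transitivity (\prod_i label_obs_prob theta (x' i) (B2 i))%:E; last first.
    congr EFin; rewrite (bigD1 jo) //= mulrC; congr (_ * _).
      by apply: eq_bigr => i /negbTE ij; rewrite /x' /B2 ij.
    by rewrite /x' /B2 eqxx.
  rewrite -(IH x' B2 mB2 (ltnW jn)) [LHS]integral_mkcond; apply: eq_integral => w _.
  rewrite epatch_indic /= -EFinM; congr EFin.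
  have hj : hybrid x' B2 j jo w = \1_[set w | X j w = a] w * \1_(Y j @^-1` B') w.
    by rewrite /hybrid ltnn /x' /B2 eqxx.
  rewrite [RHS](bigD1 jo) //= [RHS]mulrC hj mulrA.
  congr (_ * _ * _); apply: eq_bigr => i /negbTE ij.
  by rewrite /hybrid /x' /B2 ij.
(* Summing over the label [a] removes the indicator and leaves [c] times the observation law. *)
have Zobs B' : measurable B' -> (\int[P]_(w in Y j @^-1` B') (Z w)%:E =
    mscale (NngNum c0) (obs_law hXY) B')%E.
  move=> mB'; transitivity (\int[P]_(w in Y j @^-1` B')
      (\sum_(a in 'I_2) (Z w * \1_[set w | X j w = a] w)%:E))%E.
    apply: eq_integral => w _; rewrite sumEFin -big_distrr /=.
    congr EFin; rewrite -[LHS]mulr1; congr (_ * _).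
    rewrite (bigD1 (X j w)) //= indic_label eqxx big1 ?addr0 // => a.
    by rewrite indic_label eq_sym => /negbTE ->.
  rewrite ge0_integral_sum //; last 3 first.
  - exact: mYB.
  - move=> a; apply/measurable_EFinP/measurable_funTS.
    by apply: measurable_funM; [exact: mZ|apply: measurable_indic; exact: mX].
  - by move=> a w _; rewrite lee_fin mulr_ge0 // indicE ler0n.
  rewrite (eq_bigr (fun a => (c * label_obs_prob theta a B')%:E)); last first.
    by move=> a _; exact: Zlabel.
  rewrite sumEFin -big_distrr /= (@sum_ord2 _ _ ord0 ord_max) //.
  by rewrite EFinM -(obs_lawE htheta hXY mB').
have := integral_law_density (mY j) Z0 iZ Zobs (mpost (x jo)) (post_ge0 (x jo)) (mB jo).
rewrite ge0_integral_mscale //; last 2 first.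
- by apply/measurable_EFinP/measurable_funTS.
- by move=> y _; rewrite lee_fin.
move=> H; transitivity (c%:E * (label_obs_prob theta (x jo) (B jo))%:E)%E; last first.
  by rewrite (bigD1 jo) //= -EFinM mulrC.
rewrite -postE //; apply: etrans H.
rewrite [RHS]integral_mkcond; apply: eq_integral => w _.
rewrite epatch_indic /= -EFinM; congr EFin.
have hj : hybrid x B j.+1 jo w = post (x jo) (Y j w) * \1_(Y j @^-1` B jo) w.
  by rewrite /hybrid ltnS leqnn.
rewrite (bigD1 jo) //= hj mulrAC; congr (_ * _ * _).
apply: eq_bigr => i ij; rewrite /hybrid ltnS leq_eqVlt.
by rewrite -[i == j :> nat]/(i == jo) (negbTE ij).
Qed.

Definition label_weight n (x : n.-tuple 'I_2) (y : n.-tuple (borel T)) : R :=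
  \prod_(i < n) post (tnth x i) (tnth y i).

Lemma label_weight_bound n (x : n.-tuple 'I_2) y : 0 <= label_weight x y <= 1.
Proof.
rewrite /label_weight; apply: (big_ind (fun z => 0 <= z <= 1)).
- by rewrite ler01 lexx.
- by move=> a b /andP[a0 a1] /andP[b0 b1]; rewrite mulr_ge0 // mulr_ile1.
- by move=> i _; rewrite post_ge0 post_le1.
Qed.

Lemma measurable_label_weight n (x : n.-tuple 'I_2) :
  measurable_fun setT (label_weight x).
Proof.
apply: measurable_prod => i _.
exact: (measurableT_comp (mpost (tnth x i)) (measurable_tnth i)).
Qed.

Lemma measurable_Yn n : measurable_fun setT (Yn Y n).
Proof.
apply/measurable_fun_tnthP => i; rewrite (_ : _ \o _ = Y i); first exact: mY.
by apply/funext => w /=; rewrite tnth_mktuple.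
Qed.

Lemma measurable_Yn_preimage n D : measurable D -> measurable (Yn Y n @^-1` D).
Proof. by move=> mD; rewrite -[X in measurable X]setTI; exact: measurable_Yn. Qed.

Lemma measurable_Xn n x : measurable [set w | Xn X n w = x].
Proof.
rewrite (_ : [set w | _] = \bigcap_(i in [set: 'I_n]) [set w | X i w = tnth x i]).
  by apply: fin_bigcap_measurable => // i _; exact: mX.
apply/seteqP; split=> w /= H; first by move=> i _ /=; rewrite -H tnth_mktuple.
by apply: eq_from_tnth => i; rewrite tnth_mktuple; exact: (H i I).
Qed.

Definition rectangles n : set (set (n.-tuple (borel T))) :=
  [set A | exists2 B : 'I_n -> set (borel T), (forall i, measurable (B i)) &
     A = [set y | forall i, B i (tnth y i)]].

Lemma measurable_rectangles n :
  @measurable _ (n.-tuple (borel T)) = <<s @rectangles n >>.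
Proof.
apply/seteqP; split.
  apply: sub_sigma_algebra2.
  apply: (big_ind (fun S => S `<=` @rectangles n)) => //.
    by move=> S1 S2 H1 H2 A [/H1|/H2].
  move=> i _ A [B mB <-]; exists (fun k => if k == i then B else setT).
    by move=> k; case: (k == i).
  apply/seteqP; split=> y /=.
    by move=> [_ yB] k; case: eqP => // ->.
  by move=> /(_ i); rewrite eqxx.
apply: smallest_sub; first exact: sigma_algebra_measurable.
move=> A [B mB ->].
rewrite (_ : [set y | _] = \bigcap_(i in [set: 'I_n]) ((fun y => tnth y i) @^-1` B i)).
  apply: fin_bigcap_measurable => // i _.
  by rewrite -[X in measurable X]setTI; exact: measurable_tnth.
by apply/seteqP; split=> y H i; [move=> _; exact: H|exact: (H i I)].
Qed.

Lemma integrable_label_weight n (x : n.-tuple 'I_2) :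
  P.-integrable setT (EFin \o (label_weight x \o Yn Y n)).
Proof.
apply: (@bounded_integrable _ _ _ P _ 1) => [|w]; last exact: label_weight_bound.
exact: (measurableT_comp (measurable_label_weight x) (@measurable_Yn n)).
Qed.

(** Both sides are finite measures in [D]. They agree on rectangles, a generating family stable
    under intersection, by [integral_hybrid] at j = n on the left and by the joint law on the
    right. *)
Lemma joint_law n (x : n.-tuple 'I_2) (D : set (n.-tuple (borel T))) :
  measurable D ->
  (\int[P]_(w in Yn Y n @^-1` D) (label_weight x (Yn Y n w))%:E =
   \int[P]_(w in Yn Y n @^-1` D) (\1_[set w | Xn X n w = x] w)%:E)%E.
Proof.
have W0 w : 0 <= (label_weight x \o Yn Y n) w.
  by have /andP[] := label_weight_bound x (Yn Y n w).
have I0 w : 0 <= \1_[set w | Xn X n w = x] w :> R by rewrite indicE ler0n.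
have iI : P.-integrable setT (EFin \o \1_[set w | Xn X n w = x]).
  by apply: integrable_indic; exact: measurable_Xn.
pose m1 := law (density_measure W0 (integrable_label_weight x)) (@measurable_Yn n).
pose m2 := law (density_measure I0 iI) (@measurable_Yn n).
apply: (@measure_unique _ _ _ (@rectangles n) (fun=> setT)
  (measurable_rectangles n) _ _ _ m1 m2).
- move=> A A' [B mB ->] [B' mB' ->]; exists (fun i => B i `&` B' i).
    by move=> i; exact: measurableI.
  apply/seteqP; split=> y /=; first by move=> [H H'] i; split.
  by move=> H; split=> i; have [] := H i.
- by move=> _; exists (fun=> setT) => //; apply/seteqP; split.
- by rewrite bigcup_const //; exists 0%N.
- move=> A [B mB ->].
  have mD : measurable [set y : n.-tuple (borel T) | forall i, B i (tnth y i)].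
    by rewrite measurable_rectangles; apply: sub_sigma_algebra; exists B.
  transitivity (\prod_i label_obs_prob theta (tnth x i) (B i))%:E.
    rewrite -(integral_hybrid (tnth x) mB (leqnn n)) [LHS]integral_mkcond.
    apply: eq_integral => w _; rewrite epatch_indic /= -EFinM; congr EFin.
    rewrite (_ : Yn Y n @^-1` _ =
      [set w | forall i : 'I_n, (Y i @^-1` B i) w]); last first.
      apply/seteqP; split=> w' /= H i; first by have := H i; rewrite tnth_mktuple.
      by rewrite tnth_mktuple; exact: H.
    rewrite -prod_indic -big_split /=; apply: eq_bigr => i _.
    by rewrite /hybrid ltn_ord tnth_mktuple.
  rewrite -(prob_labels_obs htheta hXY) //; apply/esym.
  transitivity (\int[P]_(w in Yn Y n @^-1` [set y | forall i, B i (tnth y i)])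
      (\1_[set w | Xn X n w = x] w)%:E)%E => //.
  rewrite integral_indic //; [|exact: measurable_Yn_preimage|exact: measurable_Xn].
  congr (P _); apply/seteqP; split=> w /=.
    move=> [<- H] i; have := H i; rewrite !tnth_mktuple; by split.
  move=> H; split; last by move=> i; rewrite tnth_mktuple; have [] := H i.
  by apply: eq_from_tnth => i; rewrite tnth_mktuple; have [] := H i.
- move=> _; rewrite ltey_eq; apply/orP; left; exact: fin_num_measure.
Qed.

(** The posterior law of the label vector is the product [label_weight]. The sum is a function of
    the observations, and its integrals are identified one label vector at a time. *)
Lemma condexp_labels n (phi : n.-tuple (borel T) -> n.-tuple 'I_2 -> R) M :
  (forall x, measurable_fun setT (phi^~ x)) ->
  (forall y x, 0 <= phi y x <= M) ->
  {ae P, forall w,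
    condexp P (sigma_obs Y n) (fun w => phi (Yn Y n w) (Xn X n w)) w =
    \sum_(x : n.-tuple 'I_2) phi (Yn Y n w) x * label_weight x (Yn Y n w)}.
Proof.
move=> mphi phiM.
have phi0 y x : 0 <= phi y x by have /andP[] := phiM y x.
have W0 (x : n.-tuple 'I_2) y : 0 <= label_weight x y.
  by have /andP[] := label_weight_bound x y.
have I0 (x : n.-tuple 'I_2) w : 0 <= \1_[set w | Xn X n w = x] w :> R.
  by rewrite indicE ler0n.
have mI (x : n.-tuple 'I_2) :
    measurable_fun setT (\1_[set w | Xn X n w = x] : Omega -> R).
  by apply: measurable_indic; exact: measurable_Xn.
pose z y := \sum_(x : n.-tuple 'I_2) phi y x * label_weight x y.
have mz : measurable_fun setT z.
  apply: measurable_sum => x; apply: measurable_funM => //.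
  exact: measurable_label_weight.
apply: condexp_ae.
- exact: (sigma_algebra_preimage setT (Yn Y n) (sigma_algebra_measurable _)).
- by move=> A [D mD <-]; exact: measurable_Yn.
split.
- move=> B mB; exists (z @^-1` B).
    by rewrite -[X in measurable X]setTI; exact: mz.
  by rewrite setTI.
- apply: (@bounded_integrable _ _ _ P _ (\sum_(x : n.-tuple 'I_2) M)).
    exact: (measurableT_comp mz (@measurable_Yn n)).
  move=> w; apply/andP; split; first by apply: sumr_ge0 => x _; rewrite mulr_ge0.
  apply: ler_sum => x _; have /andP[_ le] := phiM (Yn Y n w) x.
  have /andP[_ le1] := label_weight_bound x (Yn Y n w).
  by apply: le_trans le; rewrite ler_piMr.
move=> A [D mD <-]; rewrite setTI.
have mYD := measurable_Yn_preimage mD.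
have mphiY x : measurable_fun setT (fun w => phi (Yn Y n w) x).
  exact: (measurableT_comp (mphi x) (@measurable_Yn n)).
transitivity (\sum_(x : n.-tuple 'I_2) \int[P]_(w in Yn Y n @^-1` D)
    (phi (Yn Y n w) x * label_weight x (Yn Y n w))%:E)%E.
  rewrite -ge0_integral_sum //.
  - by apply: eq_integral => w _; rewrite sumEFin.
  - move=> x; apply/measurable_EFinP/measurable_funTS/measurable_funM => //.
    exact: (measurableT_comp (measurable_label_weight x) (@measurable_Yn n)).
  - by move=> x w _; rewrite lee_fin mulr_ge0.
transitivity (\sum_(x : n.-tuple 'I_2) \int[P]_(w in Yn Y n @^-1` D)
    (phi (Yn Y n w) x * \1_[set w | Xn X n w = x] w)%:E)%E; last first.
  rewrite -ge0_integral_sum //.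
  - apply: eq_integral => w _; rewrite sumEFin; congr EFin.
    rewrite (bigD1 (Xn X n w)) //= indicE mem_set // mulr1 big1 ?addr0 // => x.
    by rewrite eq_sym indicE => /eqP ne; rewrite memNset // mulr0.
  - by move=> x; apply/measurable_EFinP/measurable_funTS/measurable_funM.
  - by move=> x w _; rewrite lee_fin mulr_ge0.
apply: eq_bigr => x _.
have iI : P.-integrable setT (EFin \o \1_[set w | Xn X n w = x]).
  by apply: integrable_indic; exact: measurable_Xn.
(* By [joint_law], [m] is the image under the observations both of the indicator of the label vector
   and of its weight. *)
pose m := law (density_measure (I0 x) iI) (@measurable_Yn n).
transitivity (\int[m]_(y in D) (phi y x)%:E)%E.
  apply: (integral_law_density (@measurable_Yn n) (fun w => W0 x (Yn Y n w))
    (integrable_label_weight x)) => // B mB.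
  exact: joint_law.
by apply/esym; exact: (integral_law_density (@measurable_Yn n) (I0 x) iI).
Qed.

End JointLaw.

(** * Bayes rules *)

Lemma loss_bound (R : realType) n (A : set_partition n) (x : n.-tuple 'I_2) :
  (0 < n)%N -> 0 <= loss R A (pi_n x) <= 1.
Proof.
move=> n0; rewrite /loss subr_ge0 gerBl divr_ge0 // andbT ler_pdivrMr ?ltr0n //.
rewrite mul1r ler_nat max_overlap_fibers //.
have [u [u' [uu ->]]] := label_overlap_ex (card_subsets n0) (block_of A) x.
rewrite -[leqRHS]card_ord -sum1_card /block_count -big_split /=.
apply: leq_sum => i _; have [->|_] := eqVneq (block_of A i) u.
  by rewrite (negbTE uu) addn0 leq_b1.
by rewrite leq_b1.
Qed.

Section DiscreteMeasurability.
Context d (S : measurableType d).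

Lemma discrete_mfun_finite (F : finType) (g : S -> F) :
  (forall a, measurable [set y | g y = a]) -> discrete_mfun g.
Proof.
move=> mg A; rewrite (_ : g @^-1` A = \bigcup_(a in A) [set y | g y = a]).
  by apply: fin_bigcup_measurable => // a _; exact: mg.
apply/seteqP; split=> y /=; first by exists (g y).
by move=> [a Aa /= ga]; rewrite ga.
Qed.

Lemma discrete_mfun_comp (F F' : Type) (g : S -> F) (k : F -> F') :
  discrete_mfun g -> discrete_mfun (k \o g).
Proof. by move=> mg A; exact: (mg (k @^-1` A)). Qed.

Lemma discrete_mfun_pair (F F' : finType) (g : S -> F) (g' : S -> F') :
  discrete_mfun g -> discrete_mfun g' -> discrete_mfun (fun y => (g y, g' y)).
Proof.
move=> mg mg'; apply: discrete_mfun_finite => -[a b].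
rewrite (_ : [set y | _] = g @^-1` [set a] `&` g' @^-1` [set b]).
  by apply: measurableI; [exact: mg|exact: mg'].
by apply/seteqP; split=> y /=; [case|case=> -> ->].
Qed.

Lemma discrete_mfun_measurable (R : realType) (F : Type) (g : S -> F) (k : F -> R) :
  discrete_mfun g -> measurable_fun setT (k \o g).
Proof. by move=> mg _ B _; rewrite setTI; exact: (mg (k @^-1` B)). Qed.

End DiscreteMeasurability.

Section BayesRules.
Context (R : realType) (T : ptopologicalType).
Context (L : {measure set (borel T) -> \bar R}) (theta : hmm_param L 2).
Hypothesis htheta : Theta_ind theta.
Context d (Omega : measurableType d) (P : probability Omega R).
Context (X : nat -> Omega -> 'I_2) (Y : nat -> Omega -> borel T).
Hypothesis hXY : hmm_law theta P X Y.
Variable post : 'I_2 -> borel T -> R.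
Hypothesis mpost : forall a, measurable_fun setT (post a).
Hypothesis post_ge0 : forall a y, 0 <= post a y.
Hypothesis post_sum1 : forall y, \sum_a post a y = 1.
Hypothesis postE : forall a B, measurable B ->
  (\int[obs_law hXY]_(y in B) (post a y)%:E = (label_obs_prob theta a B)%:E)%E.
Variable n : nat.
Hypothesis n_gt0 : (0 < n)%N.

Let condexpE := condexp_labels htheta mpost post_ge0 post_sum1 postE.

Definition posteriors (y : n.-tuple (borel T)) (i : 'I_n) (a : 'I_2) : R :=
  post a (tnth y i).

(** All Bayes label vectors at [y] are kept, because of ties. The values lie in a finite type, so
    selections from them stay measurable. *)
Definition bayes_labels (y : n.-tuple (borel T)) : {set n.-tuple 'I_2} :=
  [set s : n.-tuple 'I_2 | [forall i, [forall a,
     posteriors y i a <= posteriors y i (tnth s i)]]]%SET.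

Lemma bayes_labelsP y (s : n.-tuple 'I_2) :
  reflect (forall i a, posteriors y i a <= posteriors y i (tnth s i))
    (s \in bayes_labels y).
Proof.
rewrite inE; apply: (iffP forallP) => H i; last by apply/forallP => a.
by move/forallP: (H i).
Qed.

Lemma measurable_posteriors i a : measurable_fun setT (fun y => posteriors y i a).
Proof. exact: (measurableT_comp (mpost a) (measurable_tnth i)). Qed.

Lemma discrete_bayes_labels : discrete_mfun bayes_labels.
Proof.
apply: discrete_mfun_finite => S.
have mle s i a : measurable [set y | posteriors y i a <= posteriors y i (tnth s i)].
  have := measurable_fun_ler (measurable_posteriors i a)
    (measurable_posteriors i (tnth s i)).
  by move=> /(_ measurableT [set true] I); rewrite setTI.
have mbl s : measurable [set y | s \in bayes_labels y].
  rewrite (_ : [set y | _] = \bigcap_(i in [set: 'I_n]) \bigcap_(a in [set: 'I_2])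
      [set y | posteriors y i a <= posteriors y i (tnth s i)]).
    by do 2! (apply: fin_bigcap_measurable => // ? _); exact: mle.
  apply/seteqP; split=> y /= H; first by move=> i _ a _; exact: bayes_labelsP.
  by apply/bayes_labelsP => i a; exact: (H i I a I).
rewrite (_ : [set y | _] = \bigcap_(s in [set: n.-tuple 'I_2])
    (if s \in S then [set y | s \in bayes_labels y]
     else ~` [set y | s \in bayes_labels y])).
  apply: fin_bigcap_measurable => // s _; case: (s \in S); first exact: mbl.
  by apply: measurableC; exact: mbl.
apply/seteqP; split=> y /= H; first by move=> s _; rewrite -H; case: ifPn => // /negP.
apply/setP => s; have := H s I; case: ifPn => //=.
by move=> _ H1; apply/negbTE/negP.
Qed.

Lemma bayes_labels_ex y : exists s, s \in bayes_labels y.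
Proof.
exists [tuple if posteriors y i ord_max <= posteriors y i ord0 then ord0 else ord_max
  | i < n].
apply/bayes_labelsP => i a; rewrite tnth_mktuple.
by case: (leP (posteriors y i ord_max)) => [|/ltW]; have [->|->] := ord2P a.
Qed.

Lemma cluster_riskE g : clusterer g ->
  {ae P, forall w, cluster_risk P X Y g w =
    expected_loss (posteriors (Yn Y n w)) (g (Yn Y n w))}.
Proof.
move=> mg; apply: (@condexpE n (fun y x => loss R (g y) (pi_n x)) 1).
  by move=> x; exact: (discrete_mfun_measurable (fun A => loss R A (pi_n x)) mg).
by move=> y x; exact: loss_bound.
Qed.

Lemma sum_label_marginal (p : 'I_n -> 'I_2 -> R) i a :
  (forall k, \sum_b p k b = 1) ->
  \sum_(x : n.-tuple 'I_2) (tnth x i == a)%:R * \prod_k p k (tnth x k) = p i a.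
Proof.
move=> p1; pose q k b := if k == i then (b == a)%:R * p k b else p k b.
transitivity (\sum_(x : n.-tuple 'I_2) \prod_k q k (tnth x k)).
  apply: eq_bigr => x _; rewrite (bigD1 i) //= [RHS](bigD1 i) //= /q eqxx mulrA.
  by congr (_ * _); apply: eq_bigr => k /negbTE ->.
rewrite sum_prod_tuple (bigD1 i) //= [X in _ * X]big1 ?mulr1; last first.
  by move=> k /negbTE ki; rewrite /q ki.
rewrite /q eqxx (bigD1 a) //= eqxx mul1r big1 ?addr0 // => b /negbTE ->.
by rewrite mul0r.
Qed.

(** The label [k] may depend on the observations: a constant [k] gives the posterior probabilities,
    and [k] equal to a coordinate of a classifier gives its probability of being right. *)
Lemma condprob_labelE (k : n.-tuple (borel T) -> 'I_2) (i : 'I_n) : discrete_mfun k ->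
  {ae P, forall w,
    condprob P (sigma_obs Y n) [set w' | X i w' = k (Yn Y n w')] w =
    posteriors (Yn Y n w) i (k (Yn Y n w))}.
Proof.
move=> mk.
pose phi y (x : n.-tuple 'I_2) : R := (tnth x i == k y)%:R.
have mphi x : measurable_fun setT (phi^~ x).
  exact: (discrete_mfun_measurable (fun a => (tnth x i == a)%:R) mk).
have phi1 y x : 0 <= phi y x <= 1.
  by rewrite /phi; case: eqP => _; rewrite ?lexx ?ler01.
have := condexpE mphi phi1.
have -> : (fun w => phi (Yn Y n w) (Xn X n w)) =
    (\1_[set w' | X i w' = k (Yn Y n w')] : Omega -> R).
  apply/funext => w; rewrite indicE /phi tnth_mktuple; congr ((nat_of_bool _)%:R).
  by apply/eqP/idP; rewrite inE.
apply: filterS => w; rewrite /condprob => ->.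
by apply: (@sum_label_marginal (posteriors (Yn Y n w))) => j; exact: post_sum1.
Qed.

Lemma bigmax_posteriors y i s : s \in bayes_labels y ->
  \big[Num.max/0]_(x : 'I_2) posteriors y i x = posteriors y i (tnth s i).
Proof.
move=> /bayes_labelsP sB; apply/eqP; rewrite eq_le; apply/andP; split.
  by apply: bigmax_le => [|a _]; [exact: post_ge0|exact: sB].
exact: le_bigmax.
Qed.

Lemma bayes_classifierP h : classifier h -> bayes_classifier P X Y h <->
  {ae P, forall w, h (Yn Y n w) \in bayes_labels (Yn Y n w)}.
Proof.
move=> mh.
have mhi i : discrete_mfun (fun y => tnth (h y) i).
  exact: (discrete_mfun_comp (fun s : n.-tuple 'I_2 => tnth s i) mh).
have Eh i := condprob_labelE i (mhi i).
have Ea (i : 'I_n) : {ae P, forall w (a : 'I_2),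
    condprob P (sigma_obs Y n) [set w' | X i w' = a] w = posteriors (Yn Y n w) i a}.
  apply: filter_forall => a; apply: (@condprob_labelE (fun=> a)) => A.
  by have [Aa|Aa] := pselect (A a); [rewrite preimage_cst mem_set|
    rewrite preimage_cst memNset].
split=> [[_ H]|H].
  have {H} H : {ae P, forall w (i : 'I_n) a,
      posteriors (Yn Y n w) i a <= posteriors (Yn Y n w) i (tnth (h (Yn Y n w)) i)}.
    apply: filter_forall => i; apply: filterS3 (H i) (Eh i) (Ea i) => w.
    move=> + <- Ew a => ->; rewrite -Ew; exact: le_bigmax.
  by apply: filterS H => w H; apply/bayes_labelsP.
split=> // i; apply: filterS3 H (Eh i) (Ea i) => w hw -> Ew.
rewrite -(bigmax_posteriors i hw); apply: eq_bigr => a _.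
by rewrite Ew.
Qed.

Lemma bayes_pi_n h : classifier h -> bayes_classifier P X Y h ->
  bayes_clusterer P X Y (@pi_n 2 n \o h).
Proof.
move=> mh /(bayes_classifierP mh) hB.
have mg : clusterer (@pi_n 2 n \o h) := discrete_mfun_comp (@pi_n 2 n) mh.
split=> // g' mg'.
apply: filterS3 hB (cluster_riskE mg) (cluster_riskE mg') => w hw -> ->.
have p0 i a : 0 <= posteriors (Yn Y n w) i a by exact: post_ge0.
have p1 i : \sum_a posteriors (Yn Y n w) i a = 1 by exact: post_sum1.
exact: (expected_loss_pi_n_le n_gt0 p0 p1 (bayes_labelsP _ _ hw)).
Qed.

(** Comparing [g] with the clusterer of a measurable Bayes classifier [h0] shows that almost surely
    [g] is the fiber partition of some Bayes label vector. Such a vector depends only on the finite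
    data [g y] and [bayes_labels y], so it can be selected measurably. *)
Lemma bayes_clusterer_pi_n g : bayes_clusterer P X Y g ->
  exists2 h, bayes_classifier P X Y h &
    {ae P, forall w, g (Yn Y n w) = pi_n (h (Yn Y n w))}.
Proof.
case=> mg gmin; have [s0 _] := bayes_labels_ex (point : n.-tuple (borel T)).
pose pick_bayes (S : {set n.-tuple 'I_2}) := odflt s0 [pick s in S].
pose h0 := pick_bayes \o bayes_labels.
have mh0 : classifier h0 := discrete_mfun_comp pick_bayes discrete_bayes_labels.
have h0B y : h0 y \in bayes_labels y.
  rewrite /h0 /pick_bayes /=; case: pickP => //= none.
  by have [s sB] := bayes_labels_ex y; have := none s; rewrite /= sB.
have mg0 : clusterer (@pi_n 2 n \o h0) := discrete_mfun_comp (@pi_n 2 n) mh0.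
(* Where [g] is not of this form, a null event, an arbitrary Bayes label vector is returned, so that
   [h] is Bayes everywhere. *)
pose select (z : set_partition n * {set n.-tuple 'I_2}) :=
  odflt (pick_bayes z.2) [pick s in z.2 | pi_n s == z.1].
pose h y := select (g y, bayes_labels y).
have mh : classifier h.
  apply: (discrete_mfun_comp select).
  exact: (@discrete_mfun_pair _ _
    {A : {set {set 'I_n}} | finset.partition A [set: 'I_n]%SET} _ g bayes_labels
    mg discrete_bayes_labels).
have hB y : h y \in bayes_labels y.
  rewrite /h /select /=; case: pickP => [s /andP[]|_] //=; exact: h0B.
exists h; first by apply/(bayes_classifierP mh); apply: aeW.
apply: filterS3 (gmin _ mg0) (cluster_riskE mg) (cluster_riskE mg0) => w le Eg E0.
move: le; rewrite Eg E0.
move=> /(@expected_loss_min _ _ n_gt0 (posteriors (Yn Y n w)) (h0 (Yn Y n w))).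
have p0 i a : 0 <= posteriors (Yn Y n w) i a by exact: post_ge0.
have p1 i : \sum_a posteriors (Yn Y n w) i a = 1 by exact: post_sum1.
move=> /(_ p0 p1 (bayes_labelsP _ _ (h0B _)))[s /bayes_labelsP sB gs].
rewrite /h /select /=; case: pickP => [s' /andP[_ /eqP <-] //|].
by move=> /(_ s) /=; rewrite sB gs eqxx.
Qed.

End BayesRules.

Theorem theorem4 (R : realType) (T : ptopologicalType)
    (hT : polish_space R T) (L : {measure set (borel T) -> \bar R})
    (theta : hmm_param L 2) (htheta : Theta_ind theta)
    (d : measure_display) (Omega : measurableType d)
    (P : probability Omega R)
    (X : nat -> Omega -> 'I_2) (Y : nat -> Omega -> borel T)
    (hXY : hmm_law theta P X Y)
    (n : nat) (hn : (2 <= n)%N) :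
  (forall g, bayes_clusterer P X Y g ->
     exists2 h : n.-tuple (borel T) -> n.-tuple 'I_2,
       bayes_classifier P X Y h &
       {ae P, forall w, g (Yn Y n w) = pi_n (h (Yn Y n w))}) /\
  (forall h : n.-tuple (borel T) -> n.-tuple 'I_2,
     bayes_classifier P X Y h ->
     exists2 g, bayes_clusterer P X Y g &
       {ae P, forall w, g (Yn Y n w) = pi_n (h (Yn Y n w))}).
Proof.
have [post [mpost post_ge0 post_sum1 postE]] := posterior_label_ex htheta hXY.
have n_gt0 := ltnW hn.
split=> [g|h hB].
  exact: (bayes_clusterer_pi_n htheta mpost post_ge0 post_sum1 postE n_gt0).
exists (@pi_n 2 n \o h); last exact: aeW.
have [mh _] := hB.
exact: (bayes_pi_n htheta mpost post_ge0 post_sum1 postE n_gt0 mh hB).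
Qed.
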